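(* For all $n \in \mathbb{N}$ we have \[\Delta_3(7^3n+82) \equiv \Delta_3(7^3n+229)\equiv \Delta_3(7^3n+278) \equiv \Delta_3(7^3n+327) \equiv 0 \pmod{7}.\]
   Context: Here $\mathbb{N}=\{0,1,2,\dots\}$. For an integer $k\ge 1$, $\Delta_k(n)$ denotes the number of broken $k$-diamond partitions of $n$ (Andrews--Paule). These numbers are characterized by the generating function \[\sum_{n=0}^\infty \Delta_k(n)q^n = q^{(k+1)/12}\frac{\eta(2z)\eta((2k+1)z)}{\eta(z)^3\eta((4k+2)z)},\] where $q=e^{2\pi i z}$ and $\eta(z)=q^{1/24}\prod_{n=1}^\infty(1-q^n)$ is Dedekind's eta function. Equivalently, as formal power series in $q$ with integer coefficients, \[\sum_{n=0}^\infty \Delta_k(n)q^n=\prod_{n=1}^\infty\frac{(1-q^{2n})(1-q^{(2k+1)n})}{(1-q^n)^3(1-q^{(4k+2)n})}.\] The claim concerns the case $k=3$; this generating function may be taken as the definition of $\Delta_3(n)$. *)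

(* Defs.v *)
(* boolp supplies the choiceType structure on the uncountable type of formal
   power series, and function extensionality. *)
From HB Require Import structures.
From mathcomp Require Import all_boot all_order all_algebra.
From mathcomp Require Import boolp.

Set Implicit Arguments.
Unset Strict Implicit.
Unset Printing Implicit Defensive.

Import GRing.Theory.
Local Open Scope ring_scope.

Record fps (R : Type) := FPS { fps_coef :> nat -> R }.

Notation "{ 'fps' R }" := (fps R) (at level 0, format "{ 'fps'  R }").

Lemma fpsP (R : Type) (f g : {fps R}) : (forall n, f n = g n) -> f = g.
Proof. by case: f g => [f] [g] /= fg; congr FPS; apply/funext. Qed.

HB.instance Definition _ (R : Type) := gen_eqMixin {fps R}.
HB.instance Definition _ (R : Type) := gen_choiceMixin {fps R}.

Section Zmodule.
Variable R : zmodType.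
Implicit Types f g : {fps R}.

Definition fps_zero : {fps R} := FPS (fun=> 0).
Definition fps_opp f : {fps R} := FPS (fun n => - f n).
Definition fps_add f g : {fps R} := FPS (fun n => f n + g n).

Fact fps_addA : associative fps_add.
Proof. by move=> f g h; apply: fpsP => n /=; rewrite addrA. Qed.
Fact fps_addC : commutative fps_add.
Proof. by move=> f g; apply: fpsP => n /=; rewrite addrC. Qed.
Fact fps_add0 : left_id fps_zero fps_add.
Proof. by move=> f; apply: fpsP => n /=; rewrite add0r. Qed.
Fact fps_addN : left_inverse fps_zero fps_opp fps_add.
Proof. by move=> f; apply: fpsP => n /=; rewrite addNr. Qed.

HB.instance Definition _ := GRing.isZmodule.Build {fps R}
  fps_addA fps_addC fps_add0 fps_addN.

Lemma fps0E n : (0 : {fps R}) n = 0. Proof. by []. Qed.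
Lemma fpsDE f g n : (f + g) n = f n + g n. Proof. by []. Qed.
Lemma fpsNE f n : (- f) n = - f n. Proof. by []. Qed.

End Zmodule.

Section Ring.
Variable R : comNzRingType.
Implicit Types f g : {fps R}.

Definition fps_one : {fps R} := FPS (fun n => (n == 0%N)%:R).
Definition fps_mul f g : {fps R} :=
  FPS (fun n => \sum_(i < n.+1) f i * g (n - i)%N).

Let trunc N f : {poly R} := \poly_(i < N) f i.

Let truncM N f g n : (n < N)%N ->
  fps_mul f g n = (trunc N f * trunc N g)`_n.
Proof.
move=> ltnN; rewrite coefM; apply: eq_bigr => i _; rewrite !coef_poly.
by rewrite (leq_ltn_trans (leq_ord i) ltnN) (leq_ltn_trans (leq_subr i n) ltnN).
Qed.

Let coefM_eq N (p p' q q' : {poly R}) n : (n < N)%N ->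
  (forall i, (i < N)%N -> p`_i = p'`_i) ->
  (forall i, (i < N)%N -> q`_i = q'`_i) -> (p * q)`_n = (p' * q')`_n.
Proof.
move=> ltnN pp qq; rewrite !coefM; apply: eq_bigr => i _.
by rewrite pp ?qq// ?(leq_ltn_trans (leq_ord i) ltnN)//
  (leq_ltn_trans (leq_subr i n) ltnN).
Qed.

Let coef_trunc N f i : (i < N)%N -> (trunc N f)`_i = f i.
Proof. by move=> ltiN; rewrite coef_poly ltiN. Qed.

Fact fps_mulC : commutative fps_mul.
Proof.
by move=> f g; apply: fpsP => n; rewrite !(@truncM n.+1)// mulrC.
Qed.

Fact fps_mulA : associative fps_mul.
Proof.
move=> f g h; apply: fpsP => n; rewrite !(@truncM n.+1)//.
transitivity ((trunc n.+1 f * (trunc n.+1 g * trunc n.+1 h))`_n).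
  by apply: (@coefM_eq n.+1) => // i lti; rewrite coef_trunc// (@truncM n.+1).
rewrite mulrA; apply: (@coefM_eq n.+1) => // i lti.
by rewrite coef_trunc// (@truncM n.+1).
Qed.

Fact fps_mul1 : left_id fps_one fps_mul.
Proof.
move=> f; apply: fpsP => n /=; rewrite big_ord_recl /= mul1r subn0.
by rewrite big1 ?addr0// => i _; rewrite mul0r.
Qed.

Fact fps_mulDl : left_distributive fps_mul +%R.
Proof.
move=> f g h; apply: fpsP => n /=; rewrite -big_split /=.
by apply: eq_bigr => i _; rewrite mulrDl.
Qed.

Fact fps_1neq0 : fps_one != 0.
Proof.
apply/eqP => /(congr1 (fun f : {fps R} => f 0%N)) /= /eqP.
by rewrite oner_eq0.
Qed.

HB.instance Definition _ := GRing.Zmodule_isComNzRing.Build {fps R}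
  fps_mulA fps_mulC fps_mul1 fps_mulDl fps_1neq0.

Lemma fps1E n : (1 : {fps R}) n = (n == 0%N)%:R. Proof. by []. Qed.
Lemma fpsME f g n : (f * g) n = \sum_(i < n.+1) f i * g (n - i)%N.
Proof. by []. Qed.

Definition fpsX : {fps R} := FPS (fun n => (n == 1%N)%:R).

Lemma fpsXnE k n : (fpsX ^+ k) n = (n == k)%:R.
Proof.
elim: k n => [|k IHk] [|n]; rewrite ?expr0 ?fps1E// exprS fpsME.
  by rewrite big_ord1 /= mul0r.
rewrite big_ord_recl big_ord_recl /= mul0r add0r mul1r big1 => [|i _].
  by rewrite addr0 IHk /bump subSS subn0 eqSS.
by rewrite mul0r.
Qed.

(* The infinite product over m >= 1.  It is the q-adic limit of the partial
   products whenever F m = 1 mod q^m for all m >= 1 (fps_prod_lim). *)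
Definition fps_prod (F : nat -> {fps R}) : {fps R} :=
  FPS (fun n => (\prod_(1 <= m < n.+1) F m) n).

Definition fps_eqmod (N : nat) f g := forall i, (i < N)%N -> f i = g i.

Lemma fps_eqmodM N f f' g g' :
  fps_eqmod N f f' -> fps_eqmod N g g' -> fps_eqmod N (f * g) (f' * g').
Proof.
move=> ff gg i ltiN; rewrite !fpsME; apply: eq_bigr => j _.
by rewrite ff ?gg// ?(leq_ltn_trans (leq_ord j) ltiN)//
  (leq_ltn_trans (leq_subr j i) ltiN).
Qed.

Lemma fps_eqmodX N f g k : fps_eqmod N f g -> fps_eqmod N (f ^+ k) (g ^+ k).
Proof.
move=> fg; elim: k => [|k IHk]; first by rewrite !expr0.
by rewrite !exprS; apply: fps_eqmodM.
Qed.

Lemma fps_prod_lim F : (forall m, (0 < m)%N -> fps_eqmod m (F m) 1) ->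
  forall n N, (n <= N)%N -> fps_prod F n = (\prod_(1 <= m < N.+1) F m) n.
Proof.
move=> F1 n N; elim: N => [|N IHN] lenN.
  by move: lenN; rewrite leqn0 => /eqP ->.
move: lenN; rewrite leq_eqVlt => /predU1P[-> //|ltnN].
rewrite IHN // [in RHS]big_nat_recr //=.
set P := \prod_(1 <= m < N.+1) F m.
transitivity ((P * 1) n); first by rewrite mulr1.
by apply: (@fps_eqmodM N.+1) => // i lti; rewrite F1.
Qed.

End Ring.

Section UnitRing.
Variable R : comUnitRingType.
Implicit Types f g : {fps R}.

(* The first n.+1 coefficients of 1/f, by solving f * g = 1 recursively. *)
Fixpoint fps_inv_seq f n : seq R :=
  if n is n'.+1 then
    let s := fps_inv_seq f n' in
    rcons s (- (f 0%N)^-1 * \sum_(i < n) f i.+1 * s`_(n' - i))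
  else [:: (f 0%N)^-1].

Definition fps_unit : {pred {fps R}} := fun f => f 0%N \is a GRing.unit.

Definition fps_inv f : {fps R} :=
  if f \in fps_unit then FPS (fun n => (fps_inv_seq f n)`_n) else f.

Let size_inv_seq f n : size (fps_inv_seq f n) = n.+1.
Proof. by elim: n => //= n IHn; rewrite size_rcons IHn. Qed.

Let nth_inv_seq f n i : (i <= n)%N ->
  (fps_inv_seq f n)`_i = (fps_inv_seq f i)`_i.
Proof.
elim: n => [|n IHn]; first by rewrite leqn0 => /eqP ->.
rewrite leq_eqVlt => /predU1P[-> //|lein].
by rewrite [LHS]/= nth_rcons size_inv_seq lein IHn.
Qed.

Fact fps_mulV : {in fps_unit, left_inverse 1 fps_inv *%R}.
Proof.
move=> f fU; have f0U : f 0%N \is a GRing.unit by [].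
rewrite mulrC /fps_inv fU; apply: fpsP => -[|n].
  by rewrite fpsME big_ord1 /= mulrV.
rewrite fpsME big_ord_recl /= subn0 nth_rcons size_inv_seq ltnn eqxx.
rewrite mulrA mulrN mulrV// mulN1r addrC; apply/eqP; rewrite subr_eq0.
by apply/eqP/eq_bigr => i _; rewrite [in RHS]nth_inv_seq ?leq_subr.
Qed.

Fact fps_unitPl f g : g * f = 1 -> fps_unit f.
Proof.
move=> /(congr1 (fun h : {fps R} => h 0%N)).
rewrite fpsME big_ord1 /= => gf; apply/unitrPr.
by exists (g 0%N); rewrite mulrC.
Qed.

Fact fps_inv_out : {in [predC fps_unit], fps_inv =1 id}.
Proof. by move=> f; rewrite inE /fps_inv => /negPf ->. Qed.

HB.instance Definition _ := GRing.ComNzRing_hasMulInverse.Build {fps R}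
  fps_mulV fps_unitPl fps_inv_out.

Lemma fps_unitE f : (f \is a GRing.unit) = (f 0%N \is a GRing.unit).
Proof. by []. Qed.

Lemma fps_eqmodV N f : f \is a GRing.unit ->
  fps_eqmod N f 1 -> fps_eqmod N f^-1 1.
Proof.
move=> fU f1; rewrite -[f^-1]mulr1 -[X in fps_eqmod N _ X](mulVr fU).
by apply: fps_eqmodM => // i /f1.
Qed.

End UnitRing.

Notation "''q'" := (fpsX int) (at level 0).

Definition brokenDiamondFactor (k n : nat) : {fps int} :=
  (1 - 'q ^+ (2 * n)) * (1 - 'q ^+ ((2 * k + 1) * n))
  / ((1 - 'q ^+ n) ^+ 3 * (1 - 'q ^+ ((4 * k + 2) * n))).

Definition brokenDiamondGF (k : nat) : {fps int} :=
  fps_prod (brokenDiamondFactor k).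

(* The number of broken k-diamond partitions of n. *)
Definition Delta (k n : nat) : int := brokenDiamondGF k n.

Lemma one_sub_qX_eqmod m e : (m <= e)%N -> fps_eqmod m (1 - 'q ^+ e) 1.
Proof.
move=> leme i ltim; rewrite fpsDE fpsNE fpsXnE.
by rewrite (ltn_eqF (leq_trans ltim leme)) subr0.
Qed.

Lemma one_sub_qX_unit e : (0 < e)%N -> 1 - 'q ^+ e \is a GRing.unit.
Proof. by move=> e0; rewrite fps_unitE (@one_sub_qX_eqmod 1). Qed.

Lemma brokenDiamond_den_unit k n : (0 < n)%N ->
  (1 - 'q ^+ n) ^+ 3 * (1 - 'q ^+ ((4 * k + 2) * n)) \is a GRing.unit.
Proof.
by move=> n0; rewrite unitrM unitrX ?one_sub_qX_unit// muln_gt0 n0 addn2.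
Qed.

Lemma brokenDiamondFactor_eqmod k n : (0 < n)%N ->
  fps_eqmod n (brokenDiamondFactor k n) 1.
Proof.
move=> n0; have E c : (0 < c)%N -> fps_eqmod n (1 - 'q ^+ (c * n)) 1.
  by move=> c0; apply: one_sub_qX_eqmod; rewrite leq_pmull.
have E1 : fps_eqmod n (1 - 'q ^+ n) 1 by apply: one_sub_qX_eqmod.
have M f g : fps_eqmod n f 1 -> fps_eqmod n g 1 ->
    fps_eqmod n (f * g) (1 : {fps int}).
  by move=> f1 g1; rewrite -[X in fps_eqmod n _ X]mulr1; apply: fps_eqmodM.
apply: (M); first by apply: (M); apply: E => //; rewrite addn1.
apply: fps_eqmodV; first exact: brokenDiamond_den_unit.
apply: (M); last by apply: E; rewrite addn2.
by rewrite -[X in fps_eqmod n _ X](expr1n _ 3); apply: fps_eqmodX.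
Qed.

Lemma Delta_lim k n N : (n <= N)%N ->
  Delta k n = (\prod_(1 <= m < N.+1) brokenDiamondFactor k m) n.
Proof. exact: (fps_prod_lim (@brokenDiamondFactor_eqmod k)). Qed.

(* Main.v *)
(* Modulo 7 the generating function is A^4 / B^6, where A = prod (1 - q^n) and
   B = A(q^2).  Everything takes place in the power series over F_7, with the
   derivation D = q d/dq.  Since x^6 = 1 for nonzero x in F_7, the sixth power
   of D + c annihilates exactly one residue class of exponents modulo 7 and
   fixes the others, and f(q^7) = f^7; so a 7-dissection is a differential
   identity.
   The pentagonal number theorem, Jacobi's identity for A^3 and Gauss's
   identity for A^2 / B say that the exponents are squares up to an affine
   change of variable, so that A, A^3 and A^2 / B satisfy third order linear
   differential equations.  The first two determine the logarithmic derivative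
   of A: there is Q (the Eisenstein series E_4) with
     D A / A = 5 Q^2 - 5,  D Q = 2 (1 - Q^3),  q A^24 = 1 - Q^3
   (this is E_2 = E_4^2 and E_6 = 1 modulo 7).  With T = Q(q^2) the third one
   becomes the modular equation (2 Q - T)^2 (3 Q - 2 T) = 1, a rational curve:
   Q, T and D are rational in the weight 2 form M = 1 / (2 Q - T).
   Identities between polynomials in M and 1/M then give, modulo 7,
     sum Delta_3(7 n + 5) q^n = 6 A^4 B^6 =: G,
     sum G(7 m + 4) q^m = 6 M A^-4 B^10 =: H,  (D + 3)^3 H = - H,
   and the last equation says that H(m) = 0 unless (m + 3)^3 = -1 in F_7. *)

Require Import Defs.
From mathcomp Require Import all_boot all_order all_algebra.
From mathcomp Require Import boolp ring zify.
From Stdlib Require BinNat Pnat Ring_polynom InitialRing.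

Set Implicit Arguments.
Unset Strict Implicit.
Unset Printing Implicit Defensive.

Import GRing.Theory.
Local Open Scope ring_scope.

(* The [ring] of Algebra Tactics normalizes over the integers and cannot use
   7 = 0.  The tactic [ring7_with R7 E] runs Stdlib's reflexive normalizer with
   coefficients in Z/7, rewriting with the equation E, whose left-hand side must
   be a monomial (E is R7 itself when no equation is needed). *)
Section RingModulo7.
Variable R : comNzRingType.
Hypothesis R7 : 7%:R = 0 :> R.
Import Ring_theory Ring_polynom.

Lemma natr_modn7 n : (n %% 7)%:R = n%:R :> R.
Proof. by rewrite [in RHS](divn_eq n 7) natrD natrM R7 mulr0 add0r. Qed.

Definition add7 (m n : nat) : nat := ((m + n) %% 7)%N.
Definition mul7 (m n : nat) : nat := ((m * n) %% 7)%N.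
Definition opp7 (m : nat) : nat := ((6 * m) %% 7)%N.
Definition sub7 (m n : nat) : nat := add7 m (opp7 n).
Definition radd (x y : R) : R := x + y.
Definition rmul (x y : R) : R := x * y.
Definition rsub (x y : R) : R := x - y.
Definition ropp (x : R) : R := - x.
Definition rnat (n : nat) : R := n%:R.
Definition rpow (x : R) (n : nat) : R := x ^+ n.

Let rth : ring_theory 0 1 radd rmul rsub ropp eq.
Proof.
by split; [exact: add0r|exact: addrC|exact: addrA|exact: mul1r|exact: mulrC
  |exact: mulrA|exact: mulrDl| |exact: subrr].
Qed.

Let rext : ring_eq_ext radd rmul ropp eq.
Proof. by split=> [? ? -> ? ? ->|? ? -> ? ? ->|? ? ->]. Qed.

Let morph7 : ring_morph 0 1 radd rmul rsub ropp eq
  0%N 1%N add7 mul7 sub7 opp7 eqn rnat.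
Proof.
have opp7E n : rnat (opp7 n) = - rnat n.
  have o6 : 6%:R = -1 :> R by apply/eqP; rewrite -addr_eq0 natr1 R7.
  by rewrite /rnat /opp7 natr_modn7 natrM o6 mulN1r.
split=> // [m n|m n|m n|m n /eqnP -> //].
- by rewrite /rnat /add7 natr_modn7 natrD.
- by rewrite /rsub -opp7E /rnat /sub7 /add7 natr_modn7 natrD.
- by rewrite /rnat /mul7 natr_modn7 natrM.
Qed.

Let pow_th : power_theory 1 rmul eq BinNat.N.to_nat rpow.
Proof.
split=> x [|n] //=; elim/BinPos.Pos.peano_ind: n => [|n IHn]; first exact: expr1.
rewrite Pnat.Pos2Nat.inj_succ [LHS]exprS [X in _ * X]IHn.
by rewrite (pow_pos_succ (Eqsth R) (Rmul_ext rext) (@mulrA R)).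
Qed.

(** Soundness of the Stdlib normalizer for coefficients in [nat] reduced modulo 7; [lpe] lists the
    rewriting equations and 100 bounds the rounds of rewriting. *)
Lemma char7_ring_correct l lpe e1 e2 :
  interp_PElist 0 1 radd rmul rsub ropp eq rnat BinNat.N.to_nat rpow l lpe ->
  (let div := InitialRing.triv_div 0%N 1%N eqn in
   let norm := norm_subst 0%N 1%N add7 mul7 sub7 opp7 eqn div 100
     (mk_monpol_list 0%N 1%N add7 mul7 sub7 opp7 eqn div lpe) in
   Peq eqn (norm e1) (norm e2)) = true ->
  PEeval 0 1 radd rmul rsub ropp rnat BinNat.N.to_nat rpow l e1 =
  PEeval 0 1 radd rmul rsub ropp rnat BinNat.N.to_nat rpow l e2.
Proof.
have arth := Rth_ARth (Eqsth R) rext rth.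
apply: (ring_correct (Eqsth R) rext arth morph7 pow_th).
exact: (InitialRing.triv_div_th (Eqsth R) rext arth morph7).
Qed.
End RingModulo7.

(* Atoms are compared up to unification because the same element may occur at
   different but convertible structure instances. *)
Ltac atom_index x l :=
  lazymatch l with
  | cons ?y ?l' =>
    match constr:(Set) with
    | _ => let _ := lazymatch constr:(Set) with _ => unify x y end in
           constr:(BinNums.xH)
    | _ => let p := atom_index x l' in
           let s := eval compute in (BinPos.Pos.succ p) in constr:(s)
    end
  end.

Ltac add_atom x l :=
  match constr:(Set) with
  | _ => let _ := atom_index x l in constr:(l)
  | _ => let s := eval cbv [cat] in (l ++ [:: x]) in constr:(s)
  end.

Ltac is_literal n := lazymatch n with O => idtac | S ?m => is_literal m end.

Ltac atoms t l :=
  lazymatch t with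
  | @Algebra.add _ ?a ?b => let l := atoms a l in atoms b l
  | @GRing.mul _ ?a ?b => let l := atoms a l in atoms b l
  | @Algebra.opp _ ?a => atoms a l
  | @GRing.exp _ ?a _ => atoms a l
  | @Algebra.natmul _ (GRing.one _) ?n =>
    match constr:(Set) with
    | _ => let _ := lazymatch constr:(Set) with _ => is_literal n end in constr:(l)
    | _ => add_atom t l
    end
  | @GRing.one _ => constr:(l)
  | @Algebra.zero _ => constr:(l)
  | _ => add_atom t l
  end.

Ltac reify t l :=
  lazymatch t with
  | @Algebra.add _ ?a ?b => let a := reify a l in let b := reify b l in
      constr:(Ring_polynom.PEadd a b)
  | @GRing.mul _ ?a ?b => let a := reify a l in let b := reify b l in
      constr:(Ring_polynom.PEmul a b)
  | @Algebra.opp _ ?a => let a := reify a l in constr:(Ring_polynom.PEopp a)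
  | @GRing.exp _ ?a ?n => let a := reify a l in
      let n := eval compute in (BinNat.N.of_nat n) in
      constr:(Ring_polynom.PEpow a n)
  | @Algebra.natmul _ (GRing.one _) ?n =>
    match constr:(Set) with
    | _ => let _ := lazymatch constr:(Set) with _ => is_literal n end in
           constr:(@Ring_polynom.PEc nat n)
    | _ => let p := atom_index t l in constr:(@Ring_polynom.PEX nat p)
    end
  | @GRing.one _ => constr:(@Ring_polynom.PEI nat)
  | @Algebra.zero _ => constr:(@Ring_polynom.PEO nat)
  | _ => let p := atom_index t l in constr:(@Ring_polynom.PEX nat p)
  end.

Ltac ring7_with R7 E :=
  lazymatch goal with
  | |- @eq _ ?a ?b =>
    lazymatch type of R7 with
    | @eq ?T _ _ =>
    lazymatch type of E with
    | @eq _ ?c ?d =>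
      let l := constr:(@nil T) in
      let l := atoms a l in let l := atoms b l in
      let l := atoms c l in let l := atoms d l in
      let a' := reify a l in let b' := reify b l in
      let c' := reify c l in let d' := reify d l in
      let H := fresh in
      have H := @char7_ring_correct _ R7 l [:: (c', d')] a' b' E
        ltac:(vm_compute; reflexivity);
      cbv [Ring_polynom.PEeval radd rmul ropp rnat rpow BinList.nth BinList.jump
        List.tl List.hd
        BinNat.N.to_nat BinPos.Pos.to_nat BinPos.Pos.iter_op Nat.add] in H;
      exact H
    end end
  end.

(** Once the cofactor [c] is given, deducing one equation from another becomes a polynomial
    identity, left to a ring normalizer. *)
Lemma eq_of_lincomb (S : comNzRingType) (c l r x y : S) :
  l = r -> x - y = c * (l - r) -> x = y.
Proof. by move=> -> /eqP; rewrite subrr mulr0 subr_eq0 => /eqP. Qed.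

(** * Power series: truncation, the Euler operator and the substitution of q^k for q *)

Section FpsTheory.
Variable R : comNzRingType.
Implicit Types f g : {fps R}.

Lemma fps_sumE (I : Type) (r : seq I) (P : pred I) (F : I -> {fps R}) n :
  (\sum_(i <- r | P i) F i) n = \sum_(i <- r | P i) F i n.
Proof. by elim/big_rec2: _ => // i x y _ <-. Qed.

Lemma fps_mulrnE f k n : (f *+ k) n = f n *+ k.
Proof. by elim: k => [|k IHk]; rewrite ?mulr0n // !mulrS fpsDE IHk. Qed.

Lemma fps_natE k n : (k%:R : {fps R}) n = if n == 0%N then k%:R else 0.
Proof. by rewrite fps_mulrnE fps1E; case: eqP; rewrite ?mul0rn. Qed.

Lemma fps_natME k f n : (k%:R * f) n = k%:R * f n.
Proof. by rewrite !mulr_natl fps_mulrnE. Qed.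

Lemma fpsXnME k f n :
  (fpsX R ^+ k * f) n = if (n < k)%N then 0 else f (n - k)%N.
Proof.
rewrite fpsME; case: ltnP => [ltnk|lekn].
  rewrite big1 // => i _; rewrite fpsXnE ltn_eqF ?mul0r //.
  exact: leq_ltn_trans (leq_ord i) ltnk.
have ltkn : (k < n.+1)%N by [].
rewrite (bigD1 (Ordinal ltkn)) //= fpsXnE eqxx mul1r big1 ?addr0 // => i.
by rewrite -val_eqE /= fpsXnE => /negPf ->; rewrite mul0r.
Qed.

Lemma fpsXnM_inj k f g : fpsX R ^+ k * f = fpsX R ^+ k * g -> f = g.
Proof.
move=> fg; apply: fpsP => n; have := congr1 (fun h : {fps R} => h (k + n)%N) fg.
by rewrite !fpsXnME ltnNge leq_addr /= addKn.
Qed.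

Lemma fps_eqmod_refl N f : fps_eqmod N f f. Proof. by []. Qed.

Lemma fps_eqmod_sym N f g : fps_eqmod N f g -> fps_eqmod N g f.
Proof. by move=> fg i /fg. Qed.

Lemma fps_eqmod_trans N g f h :
  fps_eqmod N f g -> fps_eqmod N g h -> fps_eqmod N f h.
Proof. by move=> fg gh i ltiN; rewrite fg ?gh. Qed.

Lemma fps_eqmodW M N f g : (N <= M)%N -> fps_eqmod M f g -> fps_eqmod N f g.
Proof. by move=> leNM fg i ltiN; rewrite fg ?(leq_trans ltiN). Qed.

Lemma fps_eqmod_sum N (I : finType) (P : pred I) (F G : I -> {fps R}) :
  (forall i, P i -> fps_eqmod N (F i) (G i)) ->
  fps_eqmod N (\sum_(i | P i) F i) (\sum_(i | P i) G i).
Proof.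
by move=> FG n ltnN; rewrite !fps_sumE; apply: eq_bigr => i /FG ->.
Qed.

Lemma fps_eqmodMl N f g h : fps_eqmod N g h -> fps_eqmod N (f * g) (f * h).
Proof. by move=> gh; apply: fps_eqmodM. Qed.

Lemma fps_eqmodXnM N k f g :
  fps_eqmod (k + N) (fpsX R ^+ k * f) (fpsX R ^+ k * g) <-> fps_eqmod N f g.
Proof.
split=> fg i ltiN.
  have := fg (k + i)%N; rewrite !fpsXnME ltn_add2l addKn.
  by rewrite [(_ < k)%N]ltnNge leq_addr; apply.
by rewrite !fpsXnME; case: ltnP => // leki; rewrite fg // -(ltn_add2l k) subnKC.
Qed.

Lemma fps_eqmod_prod1 N m n (F : nat -> {fps R}) :
  (forall i, (m <= i)%N -> fps_eqmod N (F i) 1) ->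
  fps_eqmod N (\prod_(m <= i < n) F i) 1.
Proof.
move=> F1; rewrite big_seq; apply: (big_ind (fun f => fps_eqmod N f 1)) => //.
  by move=> f g f1 g1 i ltiN; rewrite (fps_eqmodM f1 g1 ltiN) mulr1.
by move=> i; rewrite mem_index_iota => /andP[lemi _]; apply: F1.
Qed.

Lemma fps_prod_eqmod (F : nat -> {fps R}) N M :
  (forall m, (0 < m)%N -> fps_eqmod m (F m) 1) ->
  (N <= M)%N -> fps_eqmod N.+1 (fps_prod F) (\prod_(1 <= m < M.+1) F m).
Proof.
move=> F1 leNM i leiN; apply: fps_prod_lim => //.
by apply: leq_trans leNM; rewrite -ltnS.
Qed.

Lemma fps_prodM (F G : nat -> {fps R}) :
  (forall m, (0 < m)%N -> fps_eqmod m (F m) 1) ->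
  (forall m, (0 < m)%N -> fps_eqmod m (G m) 1) ->
  fps_prod (fun m => F m * G m) = fps_prod F * fps_prod G.
Proof.
move=> F1 G1; apply: fpsP => n.
rewrite (@fps_eqmodM _ n.+1 _ (\prod_(1 <= m < n.+1) F m) _
  (\prod_(1 <= m < n.+1) G m)) //; try exact: fps_prod_eqmod.
by rewrite -big_split.
Qed.

(* The operator q d/dq + c, i.e. q d/dq acting on q^c f. *)
Definition euler (c : R) f : {fps R} := FPS (fun n => (n%:R + c) * f n).

Lemma eulerE c f n : euler c f n = (n%:R + c) * f n. Proof. by []. Qed.

Lemma eulerD c f g : euler c (f + g) = euler c f + euler c g.
Proof. by apply: fpsP => n; rewrite fpsDE /= -mulrDr. Qed.

Lemma eulerN c f : euler c (- f) = - euler c f.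
Proof. by apply: fpsP => n; rewrite fpsNE /= -mulrN. Qed.

Lemma eulerM c d f g : euler (c + d) (f * g) = euler c f * g + f * euler d g.
Proof.
apply: fpsP => n; rewrite fpsDE !fpsME /= big_distrr -big_split /=.
apply: eq_bigr => i _.
have -> : n%:R = i%:R + (n - i)%:R :> R by rewrite -natrD subnKC // -ltnS.
by ring.
Qed.

Lemma euler0M f g : euler 0 (f * g) = euler 0 f * g + f * euler 0 g.
Proof. by rewrite -eulerM addr0. Qed.

Lemma eulerMl c f g : euler c (f * g) = euler 0 f * g + f * euler c g.
Proof. by rewrite -eulerM add0r. Qed.

Lemma euler_nat k : euler 0 k%:R = 0.
Proof. by apply: fpsP => -[|n] /=; rewrite fps_natE /= ?addr0 ?mul0r ?mulr0. Qed.

Lemma euler1 : euler 0 1 = 0. Proof. exact: (euler_nat 1). Qed.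

Lemma eulerXn f n : euler 0 (f ^+ n) = n%:R * f ^+ n.-1 * euler 0 f.
Proof.
elim: n => [|[|n] IHn]; first by rewrite euler1 !mul0r.
  by rewrite mulr1 mul1r.
rewrite exprS euler0M IHn /= [f ^+ n.+1]exprS -[n.+2]addn1 natrD; ring.
Qed.

Lemma euler_Xq k : euler 0 (fpsX R ^+ k) = k%:R * fpsX R ^+ k.
Proof.
apply: fpsP => n; rewrite fps_natME /= fpsXnE addr0.
by case: eqP => [->|_]; rewrite ?mulr0.
Qed.

Lemma iter_eulerE c k f n : iter k (euler c) f n = (n%:R + c) ^+ k * f n.
Proof. by elim: k => [|k IHk]; rewrite ?mul1r //= IHk exprS mulrA. Qed.

(** The remainder [r] lets the upper bound advance by one: a new multiple of k appears only when [m]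
    increases. *)
Lemma sum_multiples k (G : nat -> R) m r : (0 < k)%N -> (r < k)%N ->
  \sum_(i < (k * m + r).+1) (if (k %| i)%N then G (i %/ k)%N else 0) =
  \sum_(i < m.+1) G i.
Proof.
move=> k0; elim: m r => [|m IHm] r; elim: r => [|r IHr] ltrk.
- by rewrite muln0 !big_ord1 dvdn0 div0n.
- by rewrite addnS big_ord_recr /= IHr ?(ltnW ltrk) // muln0 gtnNdvd ?addr0.
- have -> : (k * m.+1 + 0 = (k * m + k.-1).+1)%N by rewrite mulnS; lia.
  rewrite big_ord_recr IHm ?ltn_predL // [in RHS]big_ord_recr /=.
  have -> : ((k * m + k.-1).+1 = k * m.+1)%N by rewrite mulnS; lia.
  by rewrite dvdn_mulr // mulKn.
rewrite addnS big_ord_recr /= IHr ?(ltnW ltrk) // -addnS.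
by rewrite dvdn_addr ?dvdn_mulr // gtnNdvd // addr0.
Qed.

Definition subst_qX k f : {fps R} :=
  FPS (fun n => if (k %| n)%N then f (n %/ k)%N else 0).

Lemma subst_qXE k f n :
  subst_qX k f n = if (k %| n)%N then f (n %/ k)%N else 0.
Proof. by []. Qed.

Lemma subst_qXD k f g : subst_qX k (f + g) = subst_qX k f + subst_qX k g.
Proof.
by apply: fpsP => n; rewrite fpsDE /=; case: ifP; rewrite ?addr0.
Qed.

Lemma subst_qXN k f : subst_qX k (- f) = - subst_qX k f.
Proof. by apply: fpsP => n; rewrite fpsNE /=; case: ifP; rewrite ?oppr0. Qed.

Lemma subst_qX1 k : (0 < k)%N -> subst_qX k 1 = 1.
Proof.
move=> k0; apply: fpsP => -[|n]; rewrite /= ?dvdn0 ?div0n //.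
by case: ifP => // /(dvdn_leq (ltn0Sn n)) leknn; rewrite eqn0Ngt divn_gt0 // leknn.
Qed.

Lemma subst_qXM k f g : (0 < k)%N ->
  subst_qX k (f * g) = subst_qX k f * subst_qX k g.
Proof.
move=> k0; apply: fpsP => n; rewrite [in RHS]fpsME /=.
have [kn|kn] := boolP (k %| n)%N; last first.
  rewrite big1 // => i _; case: ifP => [ki|]; last by rewrite mul0r.
  case: ifP => [kni|]; last by rewrite mulr0.
  by have := dvdn_add ki kni; rewrite subnKC ?(negPf kn) // -ltnS.
case/dvdnP: kn => m ->; rewrite mulnK //.
rewrite -(sum_multiples (fun i => f i * g (m - i)%N) m k0 k0) addn0 [(k * m)%N]mulnC.
apply: eq_bigr => i _; case: ifP => [/dvdnP[j ij]|_]; last by rewrite mul0r.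
have -> : (m * k - i)%N = ((m - j) * k)%N by rewrite ij mulnBl.
by rewrite ij !mulnK // dvdn_mull.
Qed.

Lemma subst_qXX k f n : (0 < k)%N -> subst_qX k (f ^+ n) = subst_qX k f ^+ n.
Proof.
by move=> k0; elim: n => [|n IHn]; rewrite ?subst_qX1 // !exprS subst_qXM ?IHn.
Qed.

Lemma subst_qX_q k e : (0 < k)%N -> subst_qX k (fpsX R ^+ e) = fpsX R ^+ (k * e).
Proof.
move=> k0; apply: fpsP => n /=; rewrite !fpsXnE; case: ifP => [/dvdnP[m ->]|kn].
  by rewrite mulnK // mulnC eqn_pmul2l.
by case: eqP kn => // ->; rewrite dvdn_mulr.
Qed.

Lemma subst_qX_comp j k f : (0 < j)%N -> (0 < k)%N ->
  subst_qX j (subst_qX k f) = subst_qX (j * k) f.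
Proof.
move=> j0 k0; apply: fpsP => n /=; rewrite divnMA.
case: ifP => [/dvdnP[m ->]|nj].
  by rewrite mulnK // [(m * j)%N]mulnC dvdn_pmul2l.
by case: ifP => // jkn; rewrite (dvdn_trans _ jkn) ?dvdn_mulr in nj.
Qed.

Lemma subst_qX_nat k n : (0 < k)%N -> subst_qX k n%:R = n%:R.
Proof.
move=> k0; elim: n => [|n IHn]; last by rewrite !mulrS subst_qXD subst_qX1 ?IHn.
by apply: fpsP => n /=; case: ifP.
Qed.

Lemma subst_qX_eqmod k N f g : (0 < k)%N ->
  fps_eqmod N f g -> fps_eqmod (k * N) (subst_qX k f) (subst_qX k g).
Proof.
move=> k0 fg n ltn /=; case: ifP => // /dvdnP[m nm].
by rewrite nm mulnK // fg // -(ltn_pmul2l k0) [(k * m)%N]mulnC -nm.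
Qed.

Lemma subst_qX_prod k (F : nat -> {fps R}) : (0 < k)%N ->
  (forall m, (0 < m)%N -> fps_eqmod m (F m) 1) ->
  subst_qX k (fps_prod F) = fps_prod (fun m => subst_qX k (F m)).
Proof.
move=> k0 F1; apply: fpsP => n.
rewrite [RHS]/= (@subst_qX_eqmod k n.+1 _ (\prod_(1 <= m < n.+1) F m)) //.
- congr (fps_coef _ _).
  exact: (big_morph _ (fun f g => subst_qXM f g k0) (subst_qX1 k0)).
- exact: fps_prod_eqmod.
- by rewrite leq_pmull.
Qed.

Lemma euler_subst k c f : (0 < k)%N ->
  euler (k%:R * c) (subst_qX k f) = k%:R * subst_qX k (euler c f).
Proof.
move=> k0; apply: fpsP => n; rewrite fps_natME /=; case: ifP => [/dvdnP[m ->]|_].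
  by rewrite mulnK // natrM mulrC mulrA [m%:R * _]mulrC mulrDr; ring.
by rewrite !mulr0.
Qed.

End FpsTheory.

(** * Cancellation in power series over a domain *)

Section FpsDomain.
Variable R : idomainType.
Implicit Types f g : {fps R}.

(** With i the least index of a nonzero coefficient of [f], coefficient i + m of [f * g] is f_i g_m
    plus terms that vanish by minimality of i or by induction on m. *)
Lemma fps_mulf_eq0 f g n : f * g = 0 -> f n != 0 -> g = 0.
Proof.
move=> fg0 fn0; have ex_f : exists n, f n != 0 by exists n.
case: (ex_minnP ex_f) => i fi0 min_i.
apply: fpsP => m; elim/ltn_ind: m => m IHm.
have := congr1 (fun h : {fps R} => h (i + m)%N) fg0; rewrite fpsME [RHS]/=.
have ltim : (i < (i + m).+1)%N by rewrite ltnS leq_addr.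
rewrite (bigD1 (Ordinal ltim)) //= addKn big1 => [/eqP|j].
  by rewrite addr0 mulf_eq0 (negPf fi0) => /eqP.
rewrite -val_eqE /= neq_ltn => /orP[ltji|ltij].
  have [->|/min_i] := eqVneq (f j) 0; first by rewrite mul0r.
  by rewrite leqNgt ltji.
have lejm : (j <= i + m)%N by rewrite -ltnS.
by rewrite IHm ?fps0E ?mulr0 //; lia.
Qed.

End FpsDomain.

(** * The Frobenius map on power series over a prime field *)

Section FpsFrobenius.
Variables (R : comNzRingType) (p : nat).
Hypothesis pcharR : p \in [pchar R].
Hypothesis frobR : forall x : R, x ^+ p = x.

Let p0 : (0 < p)%N.
Proof. by case/andP: pcharR => /prime_gt0. Qed.

Lemma fps_pchar : p \in [pchar {fps R}].
Proof.
case/andP: (pcharR) => p_prime /eqP pR0; rewrite inE p_prime; apply/eqP/fpsP => n.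
by rewrite fps_natE fps0E pR0 if_same.
Qed.

Definition fps_const (c : R) : {fps R} := FPS (fun n => if n is _.+1 then 0 else c).

Lemma fps_constX c n : fps_const c ^+ n = fps_const (c ^+ n).
Proof.
elim: n => [|n IHn]; first by apply: fpsP => -[].
rewrite !exprS IHn; apply: fpsP => -[|m]; rewrite fpsME ?big_ord1 //.
by rewrite big1 // => -[[|i] lti] _ /=; rewrite ?mulr0 ?mul0r.
Qed.

(** Writing f = c + q g, additivity of Frobenius gives f^p = c + q^p g^p, so coefficient n of f^p
    reduces to coefficient n - p of g^p. *)
Lemma fps_frobenius (f : {fps R}) : f ^+ p = subst_qX p f.
Proof.
apply: fpsP => n; elim/ltn_ind: n f => n IHn f.
pose g := FPS (fun n => f n.+1).
have fE : f = fps_const (f 0%N) + fpsX R ^+ 1 * g.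
  apply: fpsP => -[|m]; rewrite fpsDE fpsXnME /= ?addr0 //.
  by rewrite add0r subn1.
rewrite {1}fE -(pFrobenius_autE fps_pchar) raddfD /= !pFrobenius_autE.
rewrite exprMn -exprM mul1n fpsXnME fps_constX frobR.
have [->|n0] := posnP n; first by rewrite p0 dvdn0 div0n addr0.
have -> : fps_const (f 0%N) n = 0 by case: n n0 {IHn}.
rewrite add0r; case: ltnP => [ltnp|lepn]; first by rewrite gtnNdvd.
rewrite IHn ?ltn_subrL ?n0 ?p0 //= dvdn_subl // ?dvdnn.
case: ifP => // /dvdnP[[|m] nE]; first by rewrite nE in n0.
by rewrite nE mulSn addKn !mulnK // -mulSn mulnK.
Qed.
End FpsFrobenius.

(** * Change of coefficient ring *)

Section FpsMap.
Variables (R S : comNzRingType) (h : {rmorphism R -> S}).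

Definition fps_map (f : {fps R}) : {fps S} := FPS (fun n => h (f n)).

Lemma fps_mapM f g : fps_map (f * g) = fps_map f * fps_map g.
Proof.
apply: fpsP => n; rewrite fpsME /= rmorph_sum; apply: eq_bigr => i _.
by rewrite rmorphM.
Qed.

Lemma fps_mapB f g : fps_map (f - g) = fps_map f - fps_map g.
Proof. by apply: fpsP => n; rewrite fpsDE fpsNE /= rmorphB. Qed.

Lemma fps_map1 : fps_map 1 = 1.
Proof. by apply: fpsP => n; rewrite /= rmorph_nat. Qed.

Lemma fps_mapXq e : fps_map (fpsX R ^+ e) = fpsX S ^+ e.
Proof. by apply: fpsP => n; rewrite /= !fpsXnE rmorph_nat. Qed.

Lemma fps_map_prod (F : nat -> {fps R}) :
  fps_map (fps_prod F) = fps_prod (fun m => fps_map (F m)).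
Proof.
apply: fpsP => n; rewrite /=.
by rewrite -[LHS]/(fps_map _ n) (big_morph _ fps_mapM fps_map1).
Qed.
End FpsMap.

(** * Gaussian binomials and the finite Jacobi triple product *)

Section QBinomial.
Variable S : comNzRingType.
Implicit Types p z : S.

Fixpoint qbinom p N K : S :=
  match N, K with
  | _, 0%N => 1
  | 0%N, _.+1 => 0
  | N'.+1, K'.+1 => qbinom p N' K + p ^+ (N' - K') * qbinom p N' K'
  end.

Arguments qbinom : simpl never.

(** The unnormalized q-factorial (p; p)_n. *)
Definition qfact p n : S := \prod_(i < n) (1 - p ^+ i.+1).

Lemma qbinom0 p N : qbinom p N 0 = 1. Proof. by case: N. Qed.

Lemma qbinomS p N K :
  qbinom p N.+1 K.+1 = qbinom p N K.+1 + p ^+ (N - K) * qbinom p N K.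
Proof. by []. Qed.

Lemma qbinom_small p N K : (N < K)%N -> qbinom p N K = 0.
Proof.
elim: N K => [|N IHN] [|K] //; rewrite ltnS => ltNK.
by rewrite qbinomS !IHN ?mulr0 ?addr0 // leqW.
Qed.

(** The dual Pascal rule. It serves to add a factor z - p^(m+1) in [triple_sum_diag], while the
    defining rule adds a factor 1 - z p^n in [triple_sumS]. *)
Lemma qbinom_pascal p N K :
  qbinom p N.+1 K.+1 = qbinom p N K + p ^+ K.+1 * qbinom p N K.+1.
Proof.
elim: N K => [|N IHN] [|K].
- by rewrite qbinomS /= mulr0 addr0 add0r mul1r.
- by rewrite qbinomS /= !mulr0 addr0.
- rewrite qbinomS {1}IHN !qbinom0 [in RHS]qbinomS qbinom0 subn0 subn0.
  by rewrite [p ^+ N.+1]exprS; ring.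
have [leKN|ltNK] := leqP K.+1 N.
  rewrite [LHS]qbinomS subSS [in LHS](IHN K.+1) [in LHS](IHN K) !qbinomS.
  have -> : p ^+ K.+2 = p ^+ K.+1 * p by rewrite exprSr.
  have -> : p ^+ (N - K) = p ^+ (N - K.+1) * p by rewrite -exprSr -subSn.
  by rewrite !exprS; ring.
rewrite qbinomS [qbinom p N.+1 K.+2]qbinom_small // mulr0 add0r addr0.
by rewrite (eqP ltNK) mul1r.
Qed.

Lemma qbinom_fact p N K : (K <= N)%N ->
  qbinom p N K * (qfact p K * qfact p (N - K)) = qfact p N.
Proof.
have q0 : qfact p 0 = 1 by rewrite /qfact big_ord0.
elim: N K => [|N IHN] [|K]; rewrite ?qbinom0 ?subn0 ?q0 ?mul1r //.
rewrite ltnS subSS => leKN; rewrite qbinomS mulrDl.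
have qS n : qfact p n.+1 = qfact p n * (1 - p ^+ n.+1).
  by rewrite /qfact big_ord_recr.
have -> : p ^+ (N - K) * qbinom p N K * (qfact p K.+1 * qfact p (N - K)) =
    p ^+ (N - K) * (1 - p ^+ K.+1) * qfact p N by rewrite qS -(IHN K) //; ring.
have -> : qbinom p N K.+1 * (qfact p K.+1 * qfact p (N - K)) =
    (1 - p ^+ (N - K)) * qfact p N.
  move: leKN; rewrite leq_eqVlt => /predU1P[->|ltKN].
    by rewrite qbinom_small // subnn subrr !mul0r.
  by rewrite -(IHN K.+1) // -(subnSK ltKN) (qS (N - K.+1)%N); ring.
rewrite qS; have -> : p ^+ N.+1 = p ^+ (N - K) * p ^+ K.+1.
  by rewrite -exprD addnS subnK.
ring.
Qed.

(* tri K m = (K - m) (K - m - 1) / 2, with K - m computed in the integers. *)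
Definition tri K m : nat := ('C(K - m, 2) + 'C(m.+1 - K, 2))%N.

Lemma triS K m : (tri K.+1 m + m = tri K m + K)%N.
Proof.
rewrite /tri subSS; have [ltKm|lemK] := ltnP K m.
  have -> : (K.+1 - m = 0)%N by lia.
  have -> : (K - m = 0)%N by lia.
  by rewrite subSn 1?ltnW // binS bin1 !bin0n; lia.
have -> : (m - K = 0)%N by lia.
have -> : 'C(m.+1 - K, 2) = 0%N by rewrite bin_small //; lia.
by rewrite subSn // binS bin1 bin0n; lia.
Qed.

Definition triple_sum p z m N : S :=
  \sum_(K < N.+1) (-1) ^+ (m + K) * p ^+ tri K m * qbinom p N K * z ^+ K.

Lemma triple_sumS p z m N : (m <= N)%N ->
  triple_sum p z m N.+1 = triple_sum p z m N * (1 - z * p ^+ (N - m)).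
Proof.
move=> lemN; rewrite /triple_sum big_ord_recl qbinom0.
under eq_bigr => K _ do rewrite lift0 qbinomS mulrDr mulrDl.
rewrite big_split /= addrA mulrBr; congr (_ + _).
  rewrite [RHS]mulr1 [RHS]big_ord_recl /= ?qbinom0; congr (_ + _).
  rewrite big_ord_recr /= qbinom_small // mulr0 mul0r addr0.
  by apply: eq_bigr => K _; rewrite /bump /= add1n.
rewrite mulr_suml -sumrN; apply: eq_bigr => K _.
have leKN : (K <= N)%N by rewrite -ltnS.
have -> : (-1) ^+ (m + K.+1) * p ^+ tri K.+1 m * (p ^+ (N - K) * qbinom p N K)
    * z ^+ K.+1 = - ((-1) ^+ (m + K) * p ^+ (tri K.+1 m + (N - K))
                     * qbinom p N K * z ^+ K * z).
  by rewrite addnS [p ^+ (_ + _)]exprD !exprS; ring.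
have -> : (tri K.+1 m + (N - K) = tri K m + (N - m))%N.
  by have := triS K m; lia.
by rewrite [p ^+ (_ + _)]exprD; ring.
Qed.

Lemma triple_sum_diag p z m :
  triple_sum p z m.+1 m.+1 = triple_sum p z m m * (z - p ^+ m.+1).
Proof.
rewrite /triple_sum big_ord_recl qbinom0.
under eq_bigr => K _ do rewrite lift0 qbinom_pascal mulrDr mulrDl.
rewrite big_split /= mulrBr addrCA; congr (_ + _).
  rewrite mulr_suml; apply: eq_bigr => K _.
  by rewrite /tri !subSS addSn addnS !exprS; ring.
transitivity (\sum_(K < m.+2)
    (-1) ^+ (m.+1 + K) * p ^+ (tri K m.+1 + K) * qbinom p m K * z ^+ K).
  rewrite [RHS]big_ord_recl /= ?qbinom0 !addn0; congr (_ + _).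
  by apply: eq_bigr => K _; rewrite /bump /= add1n (exprD p (tri K.+1 m.+1)); ring.
rewrite big_ord_recr /= qbinom_small // mulr0 mul0r addr0.
rewrite mulr_suml -sumrN; apply: eq_bigr => K _.
by rewrite -triS /tri !subSS -/(tri K m) addSn exprS (exprD p (tri K m)); ring.
Qed.

(** Each factor 1 - p^(i+1) / z of the usual triple product is multiplied by z, so that only
    nonnegative powers of z occur. *)
Lemma finite_triple_product p z n m :
  (\prod_(i < n) (1 - z * p ^+ i)) * (\prod_(i < m) (z - p ^+ i.+1)) =
  triple_sum p z m (m + n).
Proof.
elim: n => [|n IHn]; last first.
  rewrite big_ord_recr /= addnS triple_sumS ?leq_addr // -IHn addKn; ring.
rewrite big_ord0 mul1r addn0; elim: m => [|m IHm]; last first.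
  by rewrite big_ord_recr IHm triple_sum_diag.
by rewrite big_ord0 /triple_sum big_ord1 /tri /= !mul1r.
Qed.

Lemma qfact_dissect2 p n :
  qfact p (2 * n) = qfact (p ^+ 2) n * \prod_(i < n) (1 - p ^+ (2 * i + 1)).
Proof.
rewrite /qfact; elim: n => [|n IHn]; first by rewrite !big_ord0 mulr1.
rewrite mulnS !addSn add0n !big_ord_recr /= IHn -!exprM.
by rewrite addn1 mulnS !addSn add0n; ring.
Qed.

Lemma qfact_dissect3 p n :
  qfact p (3 * n) = qfact (p ^+ 3) n *
    ((\prod_(i < n) (1 - p ^+ (3 * i + 1))) *
     (\prod_(i < n) (1 - p ^+ (3 * i + 2)))).
Proof.
rewrite /qfact; elim: n => [|n IHn]; first by rewrite !big_ord0 !mulr1.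
rewrite mulnS !addSn add0n !big_ord_recr /= IHn -!exprM.
by rewrite addn2 addn1 mulnS !addSn add0n; ring.
Qed.

End QBinomial.

Lemma rmorph_qbinom (S T : comNzRingType) (h : {rmorphism S -> T}) p N K :
  h (qbinom p N K) = qbinom (h p) N K.
Proof.
elim: N K => [|N IHN] [|K] /=; rewrite ?rmorph1 ?rmorph0 //.
by rewrite rmorphD rmorphM rmorphXn !IHN.
Qed.

(* The z-derivative at z = 1 of the finite triple product. *)
Lemma finite_jacobi_cube (S : comNzRingType) (p : S) n :
  qfact p n * qfact p n.+1 =
  - \sum_(K < (n.+1 + n.+1).+1)
      (-1) ^+ (n.+1 + K) * p ^+ tri K n.+1 * qbinom p (n.+1 + n.+1) K * K%:R.
Proof.
set N := n.+1; have := finite_triple_product p%:P 'X N N.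
pose F : {poly S} := \prod_(i < n) (1 - 'X * p%:P ^+ i.+1).
pose G : {poly S} := \prod_(i < N) ('X - p%:P ^+ i.+1).
have -> : \prod_(i < N) (1 - 'X * p%:P ^+ i) = (1 - 'X) * F.
  by rewrite big_ord_recl expr0 mulr1.
(* The factor 1 - X vanishes at 1, so the derivative of (1 - X) F G there is - F(1) G(1). *)
rewrite -/G -mulrA => /(congr1 (fun g : {poly S} => - (g^`()).[1])).
rewrite derivM hornerD !hornerM derivB derivC derivX !hornerE subrr mul0r.
rewrite addr0 /= mulN1r mulNr opprK.
have -> : F.[1] = qfact p n.
  rewrite horner_prod; apply: eq_bigr => i _.
  by rewrite -rmorphXn hornerD hornerN hornerM hornerX !hornerC mul1r.
have -> : G.[1] = qfact p N.
  rewrite horner_prod; apply: eq_bigr => i _.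
  by rewrite -rmorphXn hornerD hornerN hornerX !hornerC.
move=> ->; rewrite /triple_sum raddf_sum /= horner_sum; congr (- _).
apply: eq_bigr => K _.
have -> : (-1) ^+ (N + K) * p%:P ^+ tri K N * qbinom p%:P (N + N) K =
    ((-1) ^+ (N + K) * p ^+ tri K N * qbinom p (N + N) K)%:P :> {poly S}.
  by rewrite -(rmorph_qbinom polyC) !rmorphM !rmorphXn rmorphN1.
by rewrite derivM derivC mul0r add0r hornerCM derivXn hornerMn hornerXn expr1n.
Qed.

(** The error in [qbinom_euler_prod] starts at exponent min(K, 2n - K) + 1 of the base; multiplied
    by its power [tri K n], it starts at n or later. *)
Lemma tri_lower K n : (K <= n + n)%N -> (n <= tri K n + (minn K (n + n - K)).+1)%N.
Proof.
move=> leK; have bin2_ge j : (j <= 'C(j.+1, 2))%N by rewrite binS bin1 leq_addl.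
rewrite /tri; have [ltKn|lenK] := ltnP K n.
  by rewrite subSn 1?ltnW //; have := bin2_ge (n - K)%N; move: 'C(_, _) => c; lia.
have [->|ltnK] := eqVneq K n; first by rewrite subnn; lia.
by have := bin2_ge (K - n).-1; rewrite prednK; lia.
Qed.

Lemma tri_natr (R : comNzRingType) K n :
  2%:R * (tri K n)%:R = (K%:R - n%:R) * (K%:R - n%:R - 1) :> R.
Proof.
have C2 m : 2%:R * ('C(m, 2))%:R = m%:R * (m%:R - 1) :> R.
  elim: m => [|m IHm]; first by rewrite mul0r mulr0.
  by rewrite binS bin1 natrD mulrDr IHm -natr1; ring.
rewrite /tri natrD mulrDr !C2; have [ltKn|lenK] := ltnP K n.
  have -> : (K - n = 0)%N by lia.
  by rewrite subSn 1?ltnW // -natr1 natrB 1?ltnW //; ring.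
have [->|ltnK] := eqVneq K n; first by rewrite subnn subSnn; ring.
have -> : (n.+1 - K = 0)%N by lia.
by rewrite natrB //; ring.
Qed.

(** * Euler products and truncated theta series *)

Section Theta.
Variable R : comUnitRingType.
Local Notation q := (fpsX R).
Implicit Types f g : {fps R}.

Definition euler_prod d : {fps R} := fps_prod (fun m => 1 - q ^+ (d * m)).

Lemma euler_prodE d : euler_prod d = fps_prod (fun m => 1 - q ^+ (d * m)).
Proof. by []. Qed.

Lemma one_sub_q_eqmod m e : (m <= e)%N -> fps_eqmod m (1 - q ^+ e) 1.
Proof.
move=> leme i ltim; rewrite fpsDE fpsNE fpsXnE.
by rewrite (ltn_eqF (leq_trans ltim leme)) subr0.
Qed.

Lemma euler_factor_eqmod d m : (0 < d)%N -> fps_eqmod m (1 - q ^+ (d * m)) 1.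
Proof. by move=> d0; apply: one_sub_q_eqmod; rewrite leq_pmull. Qed.

Lemma qfactE d n : qfact (q ^+ d) n = \prod_(1 <= m < n.+1) (1 - q ^+ (d * m)).
Proof.
rewrite /qfact big_add1 /= big_mkord; apply: eq_bigr => i _.
by rewrite exprM.
Qed.

Lemma euler_prod_eqmod d n : (0 < d)%N ->
  fps_eqmod (d * n.+1) (euler_prod d) (qfact (q ^+ d) n).
Proof.
move=> d0; have le_n : (n <= d * n.+1)%N by nia.
apply: (@fps_eqmod_trans _ _ (\prod_(1 <= m < (d * n.+1).+1) (1 - q ^+ (d * m)))).
  apply: (@fps_eqmodW _ (d * n.+1).+1) => //; apply: fps_prod_eqmod => // m _.
  exact: euler_factor_eqmod.
rewrite (big_cat_nat (n := n.+1)) //=.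
rewrite -qfactE -[X in fps_eqmod _ _ X]mulr1; apply: fps_eqmodMl.
apply: fps_eqmod_prod1 => m ltnm; apply: one_sub_q_eqmod.
by rewrite leq_pmul2l.
Qed.

Lemma euler_prod0 d : euler_prod d 0%N = 1.
Proof. by rewrite /= big_geq. Qed.

Lemma euler_prod1_coef1 : euler_prod 1 1%N = -1.
Proof. by rewrite /= big_nat1 muln1 expr1 fpsDE fpsNE /= sub0r. Qed.

Lemma euler_prod_unit d : euler_prod d \is a GRing.unit.
Proof. by rewrite fps_unitE euler_prod0 unitr1. Qed.

Lemma subst_euler_prod j d : (0 < j)%N -> (0 < d)%N ->
  subst_qX j (euler_prod d) = euler_prod (j * d).
Proof.
move=> j0 d0; rewrite subst_qX_prod // => [|m _]; last exact: euler_factor_eqmod.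
congr fps_prod; apply: boolp.funext => m.
by rewrite subst_qXD subst_qXN subst_qX1 // subst_qX_q // mulnA.
Qed.

(** By [qbinom_fact] the binomial is a quotient of one [qfact] by two others, and all three agree
    with the infinite product to this order. *)
Lemma qbinom_euler_prod d N K : (0 < d)%N -> (K <= N)%N ->
  fps_eqmod (d * (minn K (N - K)).+1) (qbinom (q ^+ d) N K * euler_prod d) 1.
Proof.
move=> d0 leKN; set M := minn _ _; set E := euler_prod d.
have E_fact n : (M <= n)%N -> fps_eqmod (d * M.+1) E (qfact (q ^+ d) n).
  by move=> leMn; apply: fps_eqmodW (@euler_prod_eqmod d n d0); rewrite leq_pmul2l.
have EU : E \is a GRing.unit by apply: euler_prod_unit.
have -> : qbinom (q ^+ d) N K * E = qbinom (q ^+ d) N K * (E * E) * E^-1.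
  by rewrite !mulrA mulrK.
rewrite -[X in fps_eqmod _ _ X](mulrV EU); apply: fps_eqmodM => //.
apply: (@fps_eqmod_trans _ _ (qbinom (q ^+ d) N K *
    (qfact (q ^+ d) K * qfact (q ^+ d) (N - K)))).
  by apply: fps_eqmodMl; apply: fps_eqmodM; apply: E_fact; rewrite ?geq_minl ?geq_minr.
rewrite qbinom_fact //; apply/fps_eqmod_sym/E_fact.
by rewrite (leq_trans (geq_minl _ _)).
Qed.

Lemma triple_term_euler_prod d n K f : (0 < d)%N -> (K < (n + n).+1)%N ->
  fps_eqmod (d * n)
    (euler_prod d * (f * (q ^+ d) ^+ tri K n * qbinom (q ^+ d) (n + n) K))
    (f * (q ^+ d) ^+ tri K n).
Proof.
move=> d0; rewrite ltnS => leK.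
set b := qbinom _ _ _; set E := euler_prod d.
have -> : E * (f * (q ^+ d) ^+ tri K n * b) =
    f * (q ^+ (d * tri K n) * (b * E)) by rewrite exprM; ring.
have -> : f * (q ^+ d) ^+ tri K n = f * (q ^+ (d * tri K n) * 1).
  by rewrite exprM mulr1.
apply: fps_eqmodMl; set M := (minn K (n + n - K)).+1.
apply: (@fps_eqmodW _ (d * tri K n + d * M)).
  by rewrite -mulnDr leq_pmul2l // tri_lower.
by apply/fps_eqmodXnM/qbinom_euler_prod.
Qed.

Lemma triple_product_eqmod d n z : (0 < d)%N ->
  fps_eqmod (d * n)
    (euler_prod d * ((\prod_(i < n) (1 - z * (q ^+ d) ^+ i)) *
                     (\prod_(i < n) (z - (q ^+ d) ^+ i.+1))))
    (\sum_(K < (n + n).+1) (-1) ^+ (n + K) * q ^+ (d * tri K n) * z ^+ K).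
Proof.
move=> d0; rewrite finite_triple_product /triple_sum mulr_sumr.
apply: fps_eqmod_sum => K _; rewrite mulrA exprM.
by apply: fps_eqmodM => //; apply: triple_term_euler_prod.
Qed.

Lemma q_factor_out d n : (0 < d)%N ->
  \prod_(i < n) (q - (q ^+ d) ^+ i.+1) =
  q ^+ n * \prod_(i < n) (1 - q ^+ (d * i + d.-1)).
Proof.
move=> d0; have -> : q ^+ n = \prod_(i < n) q by rewrite prodr_const card_ord.
rewrite -big_split /=.
apply: eq_bigr => i _; rewrite -exprM mulrBr mulr1 -exprS; congr (_ - _ ^+ _).
by rewrite mulnS; lia.
Qed.

Lemma prodB_q_mul d n :
  \prod_(i < n) (1 - q * (q ^+ d) ^+ i) = \prod_(i < n) (1 - q ^+ (d * i + 1)).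
Proof. by apply: eq_bigr => i _; rewrite -exprM -exprS addn1. Qed.

(** The case z = q. Taking q out of the n factors q - q^(d(i+1)) leaves q^n; cancelling it costs n
    orders of precision, and the second hypothesis keeps the subtraction in the exponent exact. *)
Lemma triple_product_q_eqmod d n : (0 < d)%N ->
  (forall K, (n <= d * tri K n + K)%N) ->
  fps_eqmod (d.-1 * n)
    (euler_prod d * ((\prod_(i < n) (1 - q ^+ (d * i + 1))) *
                     (\prod_(i < n) (1 - q ^+ (d * i + d.-1)))))
    (\sum_(K < (n + n).+1) (-1) ^+ (n + K) * q ^+ (d * tri K n + K - n)).
Proof.
move=> d0 len; have := @triple_product_eqmod d n q d0.
rewrite q_factor_out // prodB_q_mul.
have -> : (d * n = n + d.-1 * n)%N by rewrite -{1}(prednK d0) mulSn.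
set f := \prod_(i < n) _; set g := \prod_(i < n) _ => H.
apply/(fps_eqmodXnM _ n); move: H.
have -> : euler_prod d * (f * (q ^+ n * g)) = q ^+ n * (euler_prod d * (f * g)).
  by ring.
move/fps_eqmod_trans; apply.
rewrite mulr_sumr; apply: fps_eqmod_sum => K _.
by rewrite mulrCA -!exprD subnKC // -mulrA -exprD.
Qed.

Lemma qfact_euler_prod1 n : fps_eqmod n.+1 (euler_prod 1) (qfact q n).
Proof.
by have := @euler_prod_eqmod 1 n isT; rewrite mul1n expr1.
Qed.

(** In base q^3 the exponents 3i+1, 3i+2 and the multiples of 3 reassemble the full Euler
    product. *)
Lemma pentagonal_number n :
  fps_eqmod n (euler_prod 1)
    (\sum_(K < (n + n).+1) (-1) ^+ (n + K) * q ^+ (3 * tri K n + K - n)).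
Proof.
have triK K : (n <= 3 * tri K n + K)%N by have := triS K n; nia.
have H := triple_product_q_eqmod (isT : (0 < 3)%N) triK.
apply: fps_eqmod_trans (fps_eqmodW _ H); last by rewrite leq_pmull.
apply: (@fps_eqmod_trans _ _ (qfact q (3 * n))).
  by apply: fps_eqmodW (@qfact_euler_prod1 _); nia.
rewrite qfact_dissect3; apply: fps_eqmodM => //; apply/fps_eqmod_sym.
by apply: fps_eqmodW (@euler_prod_eqmod 3 n isT); nia.
Qed.

(** In base q^2 both finite products equal the product f of the 1 - q^(2i+1), and [euler_prod 2 * f]
    is [euler_prod 1] to this order; hence the extra factor [euler_prod 2]. *)
Lemma gauss_square n :
  fps_eqmod n (euler_prod 1 ^+ 2)
    (euler_prod 2 *
     \sum_(K < (n + n).+1) (-1) ^+ (n + K) * q ^+ (2 * tri K n + K - n)).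
Proof.
have triK K : (n <= 2 * tri K n + K)%N by have := triS K n; nia.
have := triple_product_q_eqmod (isT : (0 < 2)%N) triK.
rewrite mul1n; set f := \prod_(i < n) _ => H.
apply: fps_eqmod_trans (fps_eqmodMl _ H).
have -> : euler_prod 2 * (euler_prod 2 * (f * f)) = (euler_prod 2 * f) ^+ 2.
  by ring.
apply: fps_eqmodX.
apply: (@fps_eqmod_trans _ _ (qfact q (2 * n))).
  by apply: fps_eqmodW (@qfact_euler_prod1 _); nia.
rewrite qfact_dissect2; apply: fps_eqmodM => //; apply/fps_eqmod_sym.
by apply: fps_eqmodW (@euler_prod_eqmod 2 n isT); nia.
Qed.

Lemma jacobi_cube n : (0 < n)%N ->
  fps_eqmod n (euler_prod 1 ^+ 3)
    (- \sum_(K < (n + n).+1) (-1) ^+ (n + K) * K%:R * q ^+ tri K n).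
Proof.
case: n => // n _; set E := euler_prod 1; set N := n.+1.
have E_fact m : (n <= m)%N -> fps_eqmod N E (qfact q m).
  by move=> lenm; apply: fps_eqmodW (@qfact_euler_prod1 m).
have -> : E ^+ 3 = E * (E * E) by ring.
apply: (@fps_eqmod_trans _ _ (E * (qfact q n * qfact q N))).
  by apply: fps_eqmodMl; apply: fps_eqmodM; apply: E_fact.
rewrite finite_jacobi_cube mulrN mulr_sumr -!sumrN.
apply: fps_eqmod_sum => K _; rewrite -mulrN -[in X in fps_eqmod _ _ X]mulrN.
have := @triple_term_euler_prod 1 N K ((-1) ^+ (N + K)) isT (ltn_ord K).
rewrite mul1n expr1 => /fps_eqmodM /(_ (@fps_eqmod_refl _ N (- K%:R))).
by rewrite -!mulrA ![in X in fps_eqmod _ _ X]mulrN [q ^+ _ * K%:R]mulrC !mulrN.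
Qed.

End Theta.

Lemma fps_map_euler_prod (R S : comUnitRingType) (h : {rmorphism R -> S}) d :
  fps_map h (euler_prod R d) = euler_prod S d.
Proof.
rewrite fps_map_prod; congr fps_prod; apply: boolp.funext => m.
by rewrite fps_mapB fps_map1 fps_mapXq.
Qed.

(* Unification must not compare infinite products by computing coefficients. *)
Opaque euler_prod.

(** * Third order differential equations modulo 7 for three theta series *)

Section PrimeField7.
Variable F : fieldType.
Hypothesis pcharF : 7 \in [pchar F].
Hypothesis frobF : forall x : F, x ^+ 7 = x.
Local Notation q := (fpsX F).
Implicit Types f g : {fps F}.

Lemma F7_char : 7%:R = 0 :> F. Proof. exact: pcharf0 pcharF. Qed.

Lemma fps7_char : 7%:R = 0 :> {fps F}.
Proof. exact: pcharf0 (fps_pchar pcharF). Qed.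

Lemma F7_exp6 (x : F) : x != 0 -> x ^+ 6 = 1.
Proof. by move=> x0; apply: (mulfI x0); rewrite -exprS frobF mulr1. Qed.

Ltac ring7F := ring7_with F7_char F7_char.

Lemma F7_natr_eq0 K : (K%:R == 0 :> F) = (7 %| K)%N.
Proof. by rewrite (dvdn_pcharf pcharF). Qed.

Lemma F7_natr_exp6 K : (K%:R : F) ^+ 6 = if (7 %| K)%N then 0 else 1.
Proof.
rewrite -F7_natr_eq0; have [->|K0] := eqVneq; first by rewrite expr0n.
exact: F7_exp6.
Qed.

Lemma F7_tri K n : (tri K n)%:R = 4%:R * ((K%:R - n%:R) * (K%:R - n%:R - 1)) :> F.
Proof.
rewrite -tri_natr; ring7F.
Qed.

Lemma frobenius49 f : f ^+ 49 = subst_qX 49 f.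
Proof.
by rewrite (exprM f 7 7) !fps_frobenius // subst_qX_comp.
Qed.

Lemma fps_sign_qE m e j : ((-1) ^+ m * q ^+ e) j = (-1) ^+ m * (j == e)%:R.
Proof.
elim: m => [|m IHm]; first by rewrite !mul1r fpsXnE.
by rewrite ![(-1) ^+ m.+1]exprS !mulN1r !mulNr fpsNE IHm.
Qed.

Lemma tri_int K n :
  (2 * (tri K n)%:Z = (K%:Z - n%:Z) * (K%:Z - n%:Z - 1))%R.
Proof. by have := tri_natr int K n; rewrite !natz. Qed.

Lemma sign7 L K : (-1) ^+ (7 * L + 7 * K) = (-1) ^+ (L + K) :> F.
Proof. by rewrite -mulnDr -signr_odd oddM /= signr_odd. Qed.

Lemma sum_if_multiples (H : nat -> F) k m r N : (r < k)%N ->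
  N = (k * m + r).+1 ->
  \sum_(K < N) (if (k %| K)%N then H K else 0) =
  \sum_(K < m.+1) H (k * K)%N.
Proof.
move=> ltrk ->; have k0 : (0 < k)%N by apply: leq_ltn_trans ltrk.
rewrite -(sum_multiples (fun K => H (k * K)%N) m k0 ltrk).
by apply: eq_bigr => K _; case: ifP => // /divnK; rewrite mulnC => ->.
Qed.

(* A pentagonal number e satisfies 24 e + 1 = (6 k - 1)^2, so (e + 5)^3 is -1 or 0;
   the terms with 7 | 6 k - 1 reassemble into - q^2 A(q^49). *)
Lemma pentagonal_dissection :
  iter 3 (euler 5%:R) (euler_prod F 1) =
  - euler_prod F 1 - q ^+ 2 * euler_prod F 1 ^+ 49.
Proof.
set A := euler_prod F 1; apply: fpsP => j; rewrite iter_eulerE.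
rewrite fpsDE !fpsNE frobenius49 fpsXnME.
apply/eqP; rewrite eq_sym addrC subr_eq; apply/eqP.
(* As n = 1 modulo 7, [pent K n + 5] is 5 K^2 modulo 7: the exceptional terms are those with 7 | K,
   and these are centred at j after division by 7. *)
pose n := (7 * j + 1)%N; pose pent K n := (3 * tri K n + K - n)%N.
have AE i m : (i < m)%N -> A i =
    \sum_(K < (m + m).+1) (-1) ^+ (m + K) * (i == pent K m)%:R.
  move=> ltim; rewrite (@pentagonal_number _ m i ltim) fps_sumE.
  by apply: eq_bigr => K _; rewrite fps_sign_qE.
have ltjn : (j < n)%N by rewrite /n; lia.
have nE K : (n <= 3 * tri K n + K)%N by have := triS K n; nia.
have pent_mod K : (pent K n)%:R + 5%:R = 5%:R * (K%:R : F) ^+ 2.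
  rewrite /pent natrB // natrD natrM F7_tri /n natrD natrM.
  ring7F.
transitivity (\sum_(K < (n + n).+1) if (7 %| K)%N then
   (-1) ^+ (n + K) * (j == pent K n)%:R else 0 : F); last first.
  rewrite (AE j n) // mulr_sumr -big_split /=.
  apply: eq_bigr => K _; case: eqP => [->|_]; last by rewrite !mulr0 addr0 if_same.
  have -> : ((pent K n)%:R + 5%:R) ^+ 3 = - (K%:R : F) ^+ 6.
    rewrite pent_mod; ring7F.
  by rewrite F7_natr_exp6; case: ifP => _; ring.
rewrite (@sum_if_multiples (fun K => (-1) ^+ (n + K) * (j == pent K n)%:R)
  7 (2 * j) 2) //; last by rewrite /n; lia.
have pent7 K : pent (7 * K)%N n = (49 * pent K j + 2)%N.
  have := tri_int (7 * K) n; have := tri_int K j.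
  by rewrite /pent /n; have := triS K j; nia.
case: ltnP => [ltj2|le2j].
  rewrite oppr0 big1 // => K _; rewrite pent7; case: eqP; last by rewrite mulr0.
  by lia.
rewrite subst_qXE; case: ifP => [/dvdnP[i ji]|nj]; last first.
  rewrite oppr0 big1 // => K _; rewrite pent7; case: eqP; last by rewrite mulr0.
  by move=> jE; rewrite jE addnK dvdn_mulr in nj.
rewrite ji mulnK // (AE i j) -?sumrN; last by lia.
have -> : (2 * j = j + j)%N by lia.
apply: eq_bigr => K _; rewrite pent7 /n addnAC addn1 exprS sign7 mulN1r mulNr.
by congr (- (_ * _%:R)); apply/eqP/eqP; lia.
Qed.

(* A triangular number e = k (k - 1) / 2 satisfies 8 e + 1 = (2 k - 1)^2; taking
   n = 3 modulo 7 turns the coefficient K = n + k of jacobi_cube into (2 k - 1) / 2,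
   which kills the terms with 7 | 2 k - 1. *)
Lemma jacobi_dissection :
  iter 3 (euler 1) (euler_prod F 1 ^+ 3) = euler_prod F 1 ^+ 3.
Proof.
apply: fpsP => j; rewrite iter_eulerE; pose n := (7 * j + 3)%N.
rewrite (@jacobi_cube _ n _ j); [|by rewrite /n; lia..].
rewrite fpsNE fps_sumE mulrN mulr_sumr; congr (- _); apply: eq_bigr => K _.
have -> : (-1) ^+ (n + K) * K%:R * q ^+ tri K n =
    K%:R * ((-1) ^+ (n + K) * q ^+ tri K n) by ring.
rewrite fps_natME fps_sign_qE; case: eqP => [->|_]; last by rewrite !mulr0.
have -> : (tri K n)%:R + 1 = 4%:R * (K%:R : F) ^+ 2.
  by rewrite F7_tri /n natrD natrM; ring7F.
have -> : (4%:R * K%:R ^+ 2) ^+ 3 = (K%:R : F) ^+ 6.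
  ring7F.
by rewrite mulrA [in LHS]mulrA -exprSr frobF -mulrA.
Qed.

(** The exponents are squares k^2, whose cubes k^6 are 0 or 1 modulo 7; the terms with 7 | k
    reassemble phi(q^49) = phi^49. *)
Lemma gauss_dissection (phi := euler_prod F 1 ^+ 2 / euler_prod F 2) :
  iter 3 (euler 0) phi = phi - phi ^+ 49.
Proof.
apply: fpsP => j; rewrite iter_eulerE addr0 fpsDE fpsNE frobenius49.
(* A multiple of 7, so that K - n and K agree modulo 7; [j.+1] rather than [j] because [phiE] at i =
   j / 49 needs i < [j.+1] even when j = 0. *)
pose n := (7 * j.+1)%N; pose sq K n := (2 * tri K n + K - n)%N.
have phiE i m : (i < m)%N -> phi i =
    \sum_(K < (m + m).+1) (-1) ^+ (m + K) * (i == sq K m)%:R.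
  move=> ltim; have /fps_eqmodM := @gauss_square F m.
  move/(_ _ _ (@fps_eqmod_refl _ m (euler_prod F 2)^-1)).
  rewrite [X in fps_eqmod _ _ X]mulrC mulKr ?euler_prod_unit // => /(_ i ltim) ->.
  by rewrite fps_sumE; apply: eq_bigr => K _; rewrite fps_sign_qE.
have ltjn : (j < n)%N by rewrite /n; lia.
have nE K : (n <= 2 * tri K n + K)%N by have := triS K n; nia.
have sq_mod K : (sq K n)%:R = (K%:R : F) ^+ 2.
  rewrite /sq natrB // natrD natrM F7_tri /n natrM.
  ring7F.
apply/eqP; rewrite eq_sym subr_eq addrC -subr_eq eq_sym; apply/eqP.
transitivity (\sum_(K < (n + n).+1) if (7 %| K)%N then
   (-1) ^+ (n + K) * (j == sq K n)%:R else 0 : F); last first.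
  rewrite (phiE j n) // mulr_sumr -sumrB.
  apply: eq_bigr => K _; case: eqP => [->|_]; last by rewrite !mulr0 subr0 if_same.
  have -> : (sq K n)%:R ^+ 3 = (K%:R : F) ^+ 6 by rewrite sq_mod -exprM.
  by rewrite F7_natr_exp6; case: ifP => _; ring.
rewrite (@sum_if_multiples (fun K => (-1) ^+ (n + K) * (j == sq K n)%:R)
  7 (2 * j.+1) 0) //; last by rewrite /n; lia.
have sq7 K : sq (7 * K)%N n = (49 * sq K j.+1)%N.
  have := tri_int (7 * K) n; have := tri_int K j.+1.
  by rewrite /sq /n; have := triS K j.+1; nia.
rewrite subst_qXE; case: ifP => [/dvdnP[i ji]|nj]; last first.
  rewrite big1 // => K _; rewrite sq7; case: eqP; last by rewrite mulr0.
  by move=> jE; rewrite jE dvdn_mulr in nj.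
have -> : (j %/ 49 = i)%N by rewrite ji mulnK.
rewrite (phiE i j.+1); last by lia.
have -> : (2 * j.+1 = j.+1 + j.+1)%N by lia.
apply: eq_bigr => K _; rewrite sq7 /n sign7.
by congr (_ * _%:R); apply/eqP/eqP; lia.
Qed.

End PrimeField7.

(** * Logarithmic derivatives and low order coefficients *)

Section LogDerivative.
Variable R : comUnitRingType.
Implicit Types f g h a b : {fps R}.

(* a is the logarithmic derivative of q^c f. *)
Definition logder (c : R) f a := euler c f = a * f.

Lemma logderM c d f g a b :
  logder c f a -> logder d g b -> logder (c + d) (f * g) (a + b).
Proof. by rewrite /logder eulerM => -> ->; ring. Qed.

Lemma logder1 : logder 0 1 0.
Proof. by rewrite /logder euler1 mul0r. Qed.

Lemma logderX c f a n : logder c f a -> logder (n%:R * c) (f ^+ n) (n%:R * a).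
Proof.
move=> fa; elim: n => [|n IHn]; first by rewrite !mul0r; apply: logder1.
by rewrite exprS -natr1 ![(_ + 1) * _]mulrDl !mul1r ![_ + c]addrC
  -natr1 ![(_ + 1) * _]mulrDl !mul1r ![_ + a]addrC; apply: logderM.
Qed.

Lemma logderV c f a : f \is a GRing.unit -> logder c f a -> logder (- c) f^-1 (- a).
Proof.
move=> fU fa; have := euler1 R; rewrite -(mulVr fU) -(addNr c) eulerM fa => H.
apply: (mulIr fU); apply/eqP; rewrite -subr_eq0; apply/eqP; rewrite -[RHS]H.
ring.
Qed.

Lemma euler0_logder n f a : logder n%:R f a -> euler 0 f = (a - n%:R) * f.
Proof.
rewrite /logder => fa; apply/eqP; rewrite mulrBl -fa eq_sym subr_eq; apply/eqP.
by apply: fpsP => m; rewrite fpsDE fps_natME /= addr0 mulrDl.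
Qed.

Lemma euler_mul_logder c f a h :
  logder c f a -> euler c (h * f) = (euler 0 h + a * h) * f.
Proof. by move=> fa; rewrite eulerMl fa; ring. Qed.

(** On multiples h f of f, the operator D + c acts on h as D + a; the right-hand factor is (D + a)^3
    applied to 1, so a linear equation for f becomes a Riccati type equation for a. *)
Lemma iter3_logder c f a : logder c f a ->
  iter 3 (euler c) f =
  (euler 0 (euler 0 a) + 3%:R * a * euler 0 a + a ^+ 3) * f.
Proof.
move=> fa /=; rewrite -{1}[f]mul1r !(euler_mul_logder _ fa) euler1 mulr1 add0r.
by rewrite eulerD euler0M; ring.
Qed.

Lemma euler_natM n f : euler 0 (n%:R * f) = n%:R * euler 0 f.
Proof. by rewrite euler0M euler_nat mul0r add0r. Qed.

Lemma fps_coef0M f g : (f * g) 0%N = f 0%N * g 0%N.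
Proof. by rewrite fpsME big_ord1. Qed.

Lemma fps_coef1M f g : (f * g) 1%N = f 0%N * g 1%N + f 1%N * g 0%N.
Proof. by rewrite fpsME !big_ord_recl big_ord0 addr0. Qed.

Lemma fps_coef2M f g :
  (f * g) 2%N = f 0%N * g 2%N + f 1%N * g 1%N + f 2%N * g 0%N.
Proof. by rewrite fpsME !big_ord_recl big_ord0 addr0 addrA. Qed.

Lemma fps_coef0X f n : (f ^+ n) 0%N = f 0%N ^+ n.
Proof. by elim: n => [|n IHn] //; rewrite !exprS fps_coef0M IHn. Qed.

Lemma fps_coef1X f n : (f ^+ n) 1%N = n%:R * f 0%N ^+ n.-1 * f 1%N.
Proof.
elim: n => [|[|n] IHn]; first by rewrite !mul0r.
  by rewrite expr1 /= expr0 !mul1r.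
rewrite exprS fps_coef1M IHn fps_coef0X /= [f 0%N ^+ n.+1]exprS -[n.+2]addn1 natrD.
ring.
Qed.

Lemma fps_coef2X f n : f 0%N = 1 ->
  2%:R * (f ^+ n) 2%N = 2%:R * n%:R * f 2%N + n%:R * (n%:R - 1) * f 1%N ^+ 2.
Proof.
move=> f0; elim: n => [|n IHn]; first by rewrite !(mul0r, mulr0) addr0.
rewrite exprS fps_coef2M fps_coef0X fps_coef1X f0 !expr1n !mulrDr mul1r IHn.
by rewrite -natr1; ring.
Qed.

End LogDerivative.

(** * Level one: Eisenstein series and the discriminant modulo 7 *)

Section LevelOne.
Variable F : fieldType.
Hypothesis pcharF : 7 \in [pchar F].
Hypothesis frobF : forall x : F, x ^+ 7 = x.
Local Notation q := (fpsX F).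
Local Notation A := (euler_prod F 1).
Local Notation D := (euler (0 : F)).
Implicit Types f g : {fps F}.

Let char7F := F7_char pcharF.
Let char7 := fps7_char pcharF.
Ltac ring7 := ring7_with char7 char7.
Ltac ring7F := ring7_with char7F char7F.

(* In F_7, 1/24 = 5, so this is the logarithmic derivative of eta. *)
Definition dlog_eta : {fps F} := euler 5%:R A / A.
Definition discr_sq : {fps F} := q ^+ 2 * A ^+ 48.
Local Notation a := dlog_eta.
Local Notation s := discr_sq.

Let AU : A \is a GRing.unit := euler_prod_unit F 1.

Lemma logder_A : logder 5%:R A a.
Proof. by rewrite /logder /dlog_eta mulrVK. Qed.

Lemma dlog_eta_pentagonal : D (D a) + 3%:R * a * D a + a ^+ 3 = - 1 - s.
Proof.
apply: (mulIr AU); rewrite -(iter3_logder logder_A) pentagonal_dissection //.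
by rewrite /discr_sq; ring.
Qed.

Lemma dlog_eta_jacobi :
  3%:R * D (D a) + 27%:R * (a * D a) + 27%:R * a ^+ 3 = 1.
Proof.
have := logderX 3 logder_A.
have -> : 3%:R * 5%:R = 1 :> F by ring7F.
move=> /iter3_logder; rewrite jacobi_dissection // !euler_natM => H.
apply: (mulIr (unitrX 3 AU)); rewrite mul1r [RHS]H; congr (_ * _); ring.
Qed.

Lemma euler_discr_sq : D s = - (a * s).
Proof.
have := logderX 48 logder_A; rewrite -natrM => /euler0_logder DA48.
rewrite /discr_sq euler0M euler_Xq DA48 natrM.
(* Modulo 7, the constant 2 - 48 * 5 is 0 and 48 is -1. *)
set x := q ^+ 2; set y := A ^+ 48; ring7.
Qed.

(** Eliminating the second derivative between the two third order equations leaves a first order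
    one. *)
Lemma dlog_eta_euler : a * D a = a ^+ 3 + 1 - s.
Proof.
have e1 := dlog_eta_pentagonal; have e2 := dlog_eta_jacobi.
move: e1 e2; set a2 := D (D a); set a1 := D a => e1 e2.
have e3 : a2 = - 1 - s - 3%:R * a * a1 - a ^+ 3 by rewrite -e1; ring.
apply: (eq_of_lincomb (c := 2%:R) e2); rewrite e3.
ring7.
Qed.

(* Modulo 7, E_4^3 = 1 - Delta because E_6 = 1 and 1728 = -1; discr_sq = Delta^2. *)
Definition one_sub_discr : {fps F} := 4%:R * (1 - a ^+ 3 - s).
(* E_2 = E_4^2 modulo 7 and a = E_2 / 24 give E_4^2 = 3 a, then divide E_4^4 = 2 a^2
   by E_4^3. *)
Definition eis4 : {fps F} := 2%:R * a ^+ 2 / one_sub_discr.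
Local Notation r := one_sub_discr.
Local Notation Q := eis4.

(** Differentiating [dlog_eta_euler] and eliminating both derivatives of a gives an algebraic
    relation between a and s. *)
Lemma one_sub_discr_sqr : r ^+ 2 = - a ^+ 3.
Proof.
have e1 := dlog_eta_pentagonal; have e2 := dlog_eta_euler.
have := congr1 D e2; rewrite euler0M !eulerD eulerN euler1 eulerXn euler_discr_sq.
move: e1 e2; rewrite /one_sub_discr; set a2 := D (D a); set a1 := D a => e1 e2 e3.
have {}e1 : a2 = - 1 - s - 3%:R * a * a1 - a ^+ 3 by rewrite -e1; ring.
(* The factor a^2 makes the first derivative occur only in the product [a * a1], which [e2]
   evaluates. *)
have e4 : (a * a1) ^+ 2 + a ^+ 3 * a2 = 3%:R * a ^+ 3 * (a * a1) + a ^+ 3 * s.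
  by apply: (eq_of_lincomb (c := a ^+ 2) e3); rewrite /=; ring.
have {}e4 : (a * a1) ^+ 2 + a ^+ 3 * (- 1 - s - 3%:R * (a * a1) - a ^+ 3) =
    3%:R * a ^+ 3 * (a * a1) + a ^+ 3 * s by rewrite -e4 e1; ring.
rewrite e2 in e4.
by apply: (eq_of_lincomb (c := 2%:R) e4); ring7.
Qed.

Lemma dlog_eta_coef0 : a 0%N = 5%:R.
Proof.
have := congr1 (fun f : {fps F} => f 0%N) logder_A.
by rewrite fps_coef0M euler_prod0 mulr1 => <-; rewrite eulerE euler_prod0 mulr1 add0r.
Qed.

Lemma dlog_eta_coef1 : a 1%N = -1.
Proof.
have := congr1 (fun f : {fps F} => f 1%N) logder_A.
rewrite eulerE fps_coef1M euler_prod0 mulr1 euler_prod1_coef1 dlog_eta_coef0 => H.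
by apply: (eq_of_lincomb (c := -1) H); ring.
Qed.

Lemma one_sub_discr_coef0 : r 0%N = 1.
Proof.
rewrite /one_sub_discr fps_natME !fpsDE !fpsNE fps_coef0X dlog_eta_coef0.
rewrite /discr_sq fpsXnME /=.
ring7F.
Qed.

Lemma one_sub_discr_coef1 : r 1%N = 6%:R.
Proof.
have a3 : (a ^+ 3) 1%N = 3%:R * (5%:R ^+ 2 * -1).
  by rewrite fps_coef1X dlog_eta_coef0 dlog_eta_coef1 mulrA.
rewrite /one_sub_discr fps_natME !fpsDE !fpsNE a3 /discr_sq fpsXnME fps1E /=.
ring7F.
Qed.

Lemma one_sub_discr_unit : r \is a GRing.unit.
Proof. by rewrite fps_unitE one_sub_discr_coef0 unitr1. Qed.

Lemma eis4_cube : Q ^+ 3 = r.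
Proof.
have rQ : r * Q = 2%:R * a ^+ 2 by rewrite /eis4 mulrC mulrVK ?one_sub_discr_unit.
apply: (mulrI (unitrX 3 one_sub_discr_unit)); rewrite -exprMn rQ.
have -> : r ^+ 3 * r = (r ^+ 2) ^+ 2 by ring.
by rewrite one_sub_discr_sqr; ring7.
Qed.

Lemma eis4_sqr : Q ^+ 2 = 3%:R * a.
Proof.
have rQ : r * Q = 2%:R * a ^+ 2 by rewrite /eis4 mulrC mulrVK ?one_sub_discr_unit.
apply: (mulrI (unitrX 2 one_sub_discr_unit)); rewrite -exprMn rQ one_sub_discr_sqr.
by ring7.
Qed.

Lemma dlog_eta_eis4 : a = 5%:R * Q ^+ 2.
Proof. rewrite eis4_sqr; ring7. Qed.

Lemma discr_sq_eis4 : s = (1 - Q ^+ 3) ^+ 2.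
Proof.
have -> : (1 - Q ^+ 3) ^+ 2 = 1 - 2%:R * Q ^+ 3 + (Q ^+ 2) ^+ 3 by ring.
rewrite eis4_cube eis4_sqr /one_sub_discr.
ring7.
Qed.

Lemma eis4_unit : Q \is a GRing.unit.
Proof. by rewrite -(unitrX_pos _ (isT : 0 < 3)%N) eis4_cube one_sub_discr_unit. Qed.

(** This is Ramanujan's D E_4 = (E_2 E_4 - E_6) / 3 with E_2 = E_4^2 and E_6 = 1. *)
Lemma eis4_euler : D Q = 2%:R * (1 - Q ^+ 3).
Proof.
have := dlog_eta_euler.
rewrite discr_sq_eis4 dlog_eta_eis4 euler_natM eulerXn /= expr1 => H.
apply: (mulrI (unitrX 3 eis4_unit)); apply: (eq_of_lincomb (c := 1) H).
ring7.
Qed.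

(** Both sides are square roots of [discr_sq]; the sign is settled because their sum has coefficient
    2 at q. *)
Lemma qA24 : q * A ^+ 24 = 1 - Q ^+ 3.
Proof.
have : (q * A ^+ 24 + (1 - Q ^+ 3)) * (q * A ^+ 24 - (1 - Q ^+ 3)) = 0.
  have -> : (q * A ^+ 24 + (1 - Q ^+ 3)) * (q * A ^+ 24 - (1 - Q ^+ 3)) =
    q ^+ 2 * A ^+ 48 - (1 - Q ^+ 3) ^+ 2 by ring.
  by rewrite -/discr_sq discr_sq_eis4 subrr.
move/fps_mulf_eq0 => /(_ 1%N) H; apply/eqP; rewrite -subr_eq0; apply/eqP/H.
have -> : (q * A ^+ 24 + (1 - Q ^+ 3)) 1%N = (q ^+ 1 * A ^+ 24) 1%N - r 1%N.
  by rewrite expr1 eis4_cube !fpsDE fpsNE fps1E add0r.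
have -> : (q ^+ 1 * A ^+ 24) 1%N = 1.
  by rewrite fpsXnME subnn fps_coef0X euler_prod0 expr1n.
rewrite one_sub_discr_coef1; have -> : 1 - 6%:R = 2%:R :> F by ring7F.
by rewrite F7_natr_eq0.
Qed.

End LevelOne.

Opaque eis4.

(** * Level two: the modular equation between Q and T *)

Section LevelTwo.
Variable F : fieldType.
Hypothesis pcharF : 7 \in [pchar F].
Hypothesis frobF : forall x : F, x ^+ 7 = x.
Local Notation q := (fpsX F).
Local Notation A := (euler_prod F 1).
Local Notation B := (euler_prod F 2).
Local Notation D := (euler (0 : F)).
Implicit Types f g : {fps F}.

Let char7F := F7_char pcharF.
Let char7 := fps7_char pcharF.
Ltac ring7 := ring7_with char7 char7.
Ltac ring7F := ring7_with char7F char7F.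

Let AU : A \is a GRing.unit := euler_prod_unit F 1.
Let BU : B \is a GRing.unit := euler_prod_unit F 2.
Local Notation Q := (eis4 F).
Definition eis4_q2 : {fps F} := subst_qX 2 Q.
Local Notation T := eis4_q2.

Lemma subst2A : subst_qX 2 A = B.
Proof. by rewrite subst_euler_prod. Qed.

Lemma subst_qXB k f g : subst_qX k (f - g) = subst_qX k f - subst_qX k g.
Proof. by rewrite subst_qXD subst_qXN. Qed.

Lemma subst_qX_natM k n f : (0 < k)%N ->
  subst_qX k (n%:R * f) = n%:R * subst_qX k f.
Proof. by move=> k0; rewrite subst_qXM // subst_qX_nat. Qed.

Lemma eis4_q2_euler : D T = 4%:R * (1 - T ^+ 3).
Proof.
rewrite /T -(mulr0 2%:R) euler_subst // eis4_euler // subst_qX_natM //.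
by rewrite subst_qXB subst_qX1 // subst_qXX // mulrA -natrM.
Qed.

Lemma q2B24 : q ^+ 2 * B ^+ 24 = 1 - T ^+ 3.
Proof.
have k2 : (0 < 2)%N by [].
have := congr1 (subst_qX 2) (qA24 pcharF frobF).
rewrite -[q]expr1 subst_qXB (subst_qXM _ _ k2) (subst_qX_q _ _ k2).
rewrite (subst_qXX A 24 k2) (subst_qXX Q 3 k2) (subst_qX1 _ k2) subst2A muln1 => H.
exact: H.
Qed.

Lemma logder_AQ : logder 5%:R A (5%:R * Q ^+ 2).
Proof. by rewrite -dlog_eta_eis4 //; apply: logder_A. Qed.

Lemma logder_BT : logder 3%:R B (3%:R * T ^+ 2).
Proof.
have -> : 3%:R = 2%:R * 5%:R :> F by ring7F.
rewrite /logder -subst2A euler_subst // logder_AQ subst_qXM // subst_qX_natM //.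
rewrite subst_qXX // -/T; set x := subst_qX 2 A; ring7.
Qed.

Local Notation phi := (A ^+ 2 / B).

Lemma logder_phi : logder 0 phi (3%:R * Q ^+ 2 - 3%:R * T ^+ 2).
Proof.
have := logderM (logderX 2 logder_AQ) (logderV BU logder_BT).
have -> : 2%:R * 5%:R - 3%:R = 0 :> F by ring7F.
have -> // : 2%:R * (5%:R * Q ^+ 2) - 3%:R * T ^+ 2 = 3%:R * Q ^+ 2 - 3%:R * T ^+ 2.
ring7.
Qed.

Lemma phi_exp48 : phi ^+ 48 * (1 - T ^+ 3) ^+ 2 = (1 - Q ^+ 3) ^+ 4.
Proof.
have phiB : phi * B = A ^+ 2 by rewrite mulrVK.
rewrite -q2B24 -(qA24 pcharF frobF); move: phiB.
move: phi => x; move: A B q => y z u H.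
have -> : x ^+ 48 * (u ^+ 2 * z ^+ 24) ^+ 2 = u ^+ 4 * (x * z) ^+ 48 by ring.
by rewrite H; ring.
Qed.

Lemma gauss_riccati w : w = 3%:R * Q ^+ 2 - 3%:R * T ^+ 2 ->
  D (D w) + 3%:R * w * D w + w ^+ 3 = 1 - phi ^+ 48.
Proof.
move=> ->; have phiU : phi \is a GRing.unit by rewrite unitrM unitrX // unitrV.
apply: (mulIr phiU); rewrite -(iter3_logder logder_phi) gauss_dissection //.
by rewrite mulrBl mul1r -exprSr.
Qed.

(* The relation between Q and T given by gauss_riccati and phi_exp48 is the product
   of the modular equation and kappa. *)
Definition kappa : {fps F} :=
  2%:R * (Q ^+ 0 * T ^+ 0) + 1%:R * (Q ^+ 0 * T ^+ 3) + 4%:R * (Q ^+ 0 * T ^+ 6) +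
  2%:R * (Q ^+ 0 * T ^+ 9) + 4%:R * (Q ^+ 1 * T ^+ 2) + 4%:R * (Q ^+ 1 * T ^+ 5) +
  4%:R * (Q ^+ 1 * T ^+ 8) + 1%:R * (Q ^+ 2 * T ^+ 1) + 4%:R * (Q ^+ 2 * T ^+ 7) +
  5%:R * (Q ^+ 3 * T ^+ 0) + 1%:R * (Q ^+ 3 * T ^+ 6) + 4%:R * (Q ^+ 4 * T ^+ 5) +
  3%:R * (Q ^+ 5 * T ^+ 1) + 1%:R * (Q ^+ 5 * T ^+ 4) + 4%:R * (Q ^+ 6 * T ^+ 0) +
  6%:R * (Q ^+ 6 * T ^+ 3) + 5%:R * (Q ^+ 7 * T ^+ 2) + 5%:R * (Q ^+ 8 * T ^+ 1) +
  3%:R * (Q ^+ 9 * T ^+ 0).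

Lemma eis4_coef0 : Q 0%N = 1.
Proof.
have := congr1 (fun f : {fps F} => f 0%N) (eis4_cube pcharF frobF).
have := congr1 (fun f : {fps F} => f 0%N) (eis4_sqr pcharF frobF).
rewrite !fps_coef0X fps_natME dlog_eta_coef0 one_sub_discr_coef0 //.
have -> : 3%:R * 5%:R = 1 :> F by ring7F.
by rewrite [Q 0%N ^+ 3]exprS => -> ; rewrite mulr1.
Qed.

Lemma eis4_coef1 : Q 1%N = 2%:R.
Proof.
have := congr1 (fun f : {fps F} => f 1%N) (eis4_cube pcharF frobF).
rewrite fps_coef1X one_sub_discr_coef1 // eis4_coef0 expr1n mulr1 => H.
apply: (eq_of_lincomb (c := 5%:R) H); ring7F.
Qed.

Lemma eis4_q2_coef : [/\ T 0%N = 1, T 1%N = 0 & T 2%N = 2%:R].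
Proof.
split; rewrite /eis4_q2 subst_qXE; [exact: eis4_coef0 | by [] | exact: eis4_coef1].
Qed.

(** This shows [kappa] nonzero; modulo 7 its coefficients of orders 0 and 1 vanish. The unknown
    [Q 2%N] drops out, being multiplied by a multiple of 7. *)
Lemma kappa_coef2 : kappa 2%N = 2%:R.
Proof.
have [T0 T1 T2] := eis4_q2_coef.
have two_inv (x y : F) : 2%:R * x = 2%:R * y -> x = y.
  by move=> H; apply: (eq_of_lincomb (c := 4%:R) H); ring7F.
have mon i j : (Q ^+ i * T ^+ j) 2%N =
    i%:R * Q 2%N + 2%:R * i%:R * (i%:R - 1) + 2%:R * j%:R.
  apply: two_inv; rewrite fps_coef2M !fps_coef0X !fps_coef1X T0 T1 eis4_coef0.
  rewrite !mulrDr.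
  have := @fps_coef2X _ Q i eis4_coef0; have := @fps_coef2X _ T j T0.
  rewrite T1 T2 eis4_coef1 !expr1n => e1 e2.
  rewrite !mul1r !mulr1 e1 e2; ring.
have cmon c i j := etrans (fps_natME c (Q ^+ i * T ^+ j) 2) (congr1 _ (mon i j)).
rewrite /kappa !fpsDE !cmon.
ring7F.
Qed.

(** Eliminating phi^48 between [gauss_riccati] and [phi_exp48] gives a polynomial relation, from
    which [kappa] is cancelled. *)
Lemma modular_equation : (2%:R * Q - T) ^+ 2 * (3%:R * Q - 2%:R * T) = 1.
Proof.
have DQ := eis4_euler pcharF frobF; have DT := eis4_q2_euler.
have Dw : D (3%:R * Q ^+ 2 - 3%:R * T ^+ 2) =
    5%:R * (Q - Q ^+ 4) - 3%:R * (T - T ^+ 4).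
  rewrite eulerD eulerN !euler_natM !eulerXn DQ DT /=.
  ring7.
have DDw : D (5%:R * (Q - Q ^+ 4) - 3%:R * (T - T ^+ 4)) =
    5%:R * (1 - 4%:R * Q ^+ 3) * (2%:R * (1 - Q ^+ 3)) -
    3%:R * (1 - 4%:R * T ^+ 3) * (4%:R * (1 - T ^+ 3)).
  rewrite eulerD eulerN !euler_natM eulerD eulerN (eulerD _ T) eulerN !eulerXn DQ DT /=.
  ring7.
have := gauss_riccati (erefl _); rewrite Dw DDw => H.
have := phi_exp48; have -> : phi ^+ 48 = 1 - (1 - phi ^+ 48) by rewrite subKr.
rewrite -H => {}H.
suff : kappa * ((2%:R * Q - T) ^+ 2 * (3%:R * Q - 2%:R * T) - 1) = 0.
  move/fps_mulf_eq0 => /(_ 2%N); rewrite kappa_coef2 F7_natr_eq0 // => /(_ isT).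
  by move/eqP; rewrite subr_eq0 => /eqP.
apply: (eq_of_lincomb (c := -1) H); rewrite /kappa.
ring7.
Qed.

End LevelTwo.

(** * Rational parametrization and the two dissections modulo 7 *)

Section Uniformizer.
Variable F : fieldType.
Hypothesis pcharF : 7 \in [pchar F].
Hypothesis frobF : forall x : F, x ^+ 7 = x.
Local Notation q := (fpsX F).
Local Notation A := (euler_prod F 1).
Local Notation B := (euler_prod F 2).
Local Notation D := (euler (0 : F)).
Implicit Types f g : {fps F}.

Let char7F := F7_char pcharF.
Let char7 := fps7_char pcharF.
Ltac ring7 := ring7_with char7 char7.
Ltac ring7F := ring7_with char7F char7F.

Let AU : A \is a GRing.unit := euler_prod_unit F 1.
Let BU : B \is a GRing.unit := euler_prod_unit F 2.
Local Notation Q := (eis4 F).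
Local Notation T := (eis4_q2 F).

(* h' in euler_step (h' := h') is the value of (D + c)^k f / f for k = 1, 2, ...; being
   homogeneous modulo E_6 = M (M^2 - 2 N) = 1, it is a Laurent polynomial in M. *)
Section RationalCurve.
Variables M t : {fps F}.
Hypotheses (mulMt : M * t = 1) (Dt : D t = M ^+ 3 - t ^+ 3) (DM : D M = t - M ^+ 5).

Lemma euler_step c f l h h' : logder c f l -> D h + l * h = h' ->
  euler c (h * f) = h' * f.
Proof. by move=> fl <-; apply: euler_mul_logder. Qed.

Ltac derive :=
  rewrite !(eulerD, euler_natM, eulerXn, euler_nat, euler1)
    ?Dt ?DM /=;
  ring7_with char7 mulMt.

(** Meant for f = A^4 / B^6, whose exponents n = 5 modulo 7 are those killed by D + 2. *)
Lemma iter6_euler_diamond f (Q := 2%:R * t - M ^+ 2) (T := 3%:R * t - 2%:R * M ^+ 2) :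
  logder 2%:R f (4%:R * (5%:R * Q ^+ 2) - 6%:R * (3%:R * T ^+ 2)) ->
  iter 6 (euler 2%:R) f = (1 - 6%:R * (1 - Q ^+ 3) * (1 - T ^+ 3) ^+ 2) * f.
Proof.
have -> : 4%:R * (5%:R * Q ^+ 2) - 6%:R * (3%:R * T ^+ 2) =
    2%:R * t ^+ 2 + 3%:R * M + 4%:R * M ^+ 4.
  rewrite /Q /T; ring7_with char7 mulMt.
move=> L; rewrite /= -{1}[f]mul1r.
rewrite (euler_step (h' := 2%:R * t ^+ 2 + 3%:R * M + 4%:R * M ^+ 4) L);
  last by derive.
rewrite (euler_step (h' := t + 3%:R * M ^+ 2) L); last by derive.
rewrite (euler_step (h' := t ^+ 3 + 1 + 6%:R * M ^+ 6) L); last by derive.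
rewrite (euler_step (h' := 6%:R * t ^+ 5 + 5%:R * t ^+ 2 + 3%:R * M
  + 3%:R * M ^+ 4 + 4%:R * M ^+ 7 + 2%:R * M ^+ 10) L); last by derive.
rewrite (euler_step (h' := 3%:R * t ^+ 7 + 4%:R * t ^+ 4 + t + M ^+ 2
  + 5%:R * M ^+ 5 + M ^+ 8 + M ^+ 11 + 2%:R * M ^+ 14) L); last by derive.
by apply: (euler_step L); rewrite /Q /T; derive.
Qed.

Lemma iter6_euler_G f (Q := 2%:R * t - M ^+ 2) (T := 3%:R * t - 2%:R * M ^+ 2) :
  logder 3%:R f (4%:R * (5%:R * Q ^+ 2) + 6%:R * (3%:R * T ^+ 2)) ->
  iter 6 (euler 3%:R) f =
    (1 - 6%:R * (4%:R * (M ^+ 2 - t)) ^+ 4 * M ^+ 7) * f.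
Proof.
have -> : 4%:R * (5%:R * Q ^+ 2) + 6%:R * (3%:R * T ^+ 2) =
    4%:R * t ^+ 2 + 5%:R * M + M ^+ 4.
  rewrite /Q /T; ring7_with char7 mulMt.
move=> L; rewrite /= -{1}[f]mul1r.
rewrite (euler_step (h' := 4%:R * t ^+ 2 + 5%:R * M + M ^+ 4) L);
  last by derive.
rewrite (euler_step (h' := t ^+ 4 + 3%:R * t + 3%:R * M ^+ 2 + 5%:R * M ^+ 5
  + 4%:R * M ^+ 8) L); last by derive.
rewrite (euler_step (h' := 3%:R + 3%:R * M ^+ 3) L); last by derive.
rewrite (euler_step (h' := 5%:R * t ^+ 2 + M + 4%:R * M ^+ 4 + M ^+ 7) L);
  last by derive.
rewrite (euler_step (h' := 3%:R * t ^+ 4 + 2%:R * t + 3%:R * M ^+ 2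
  + 3%:R * M ^+ 5 + M ^+ 11) L); last by derive.
by apply: (euler_step L); derive.
Qed.

Lemma iter3_euler_gf49 f (Q := 2%:R * t - M ^+ 2) (T := 3%:R * t - 2%:R * M ^+ 2) :
  logder 3%:R f (- (4%:R * (5%:R * Q ^+ 2)) + 10%:R * (3%:R * T ^+ 2)) ->
  iter 3 (euler 3%:R) (6%:R * M * f) = - (6%:R * M * f).
Proof.
have -> : - (4%:R * (5%:R * Q ^+ 2)) + 10%:R * (3%:R * T ^+ 2) =
    1%:R * t ^+ 2 + 2%:R * M ^+ 4.
  rewrite /Q /T; ring7_with char7 mulMt.
move=> L /=.
rewrite (euler_step (h' := 5%:R * t ^+ 1 + 6%:R * M ^+ 5) L); last by derive.
rewrite (euler_step (h' := 2%:R * M ^+ 3 + 3%:R * M ^+ 9) L); last by derive.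
rewrite -mulNr; apply: (euler_step L); derive.
Qed.

End RationalCurve.

(* wt2 is 2 E_2(q^2) - E_2(q) modulo 7, and eta_quot is q B^16 / A^8. *)
Definition wt2_inv : {fps F} := 2%:R * Q - T.
Definition wt2 : {fps F} := wt2_inv * (3%:R * Q - 2%:R * T).
Local Notation t := wt2_inv.
Local Notation M := wt2.

Lemma mulMt : M * t = 1.
Proof. by rewrite -(modular_equation pcharF frobF) /wt2 -/wt2_inv; ring. Qed.

(** With the definition of t, this makes Q and T linear in t and M^2. *)
Let wt2_sqr : M ^+ 2 = 3%:R * Q - 2%:R * T.
Proof.
have -> : M ^+ 2 = (t ^+ 2 * (3%:R * Q - 2%:R * T)) * (3%:R * Q - 2%:R * T).
  by rewrite /wt2; ring.
by rewrite modular_equation // mul1r.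
Qed.

Lemma eis4_t : Q = 2%:R * t - M ^+ 2.
Proof. by rewrite wt2_sqr /wt2_inv; ring. Qed.
Lemma eis4_q2_t : T = 3%:R * t - 2%:R * M ^+ 2.
Proof. by rewrite wt2_sqr /wt2_inv; ring. Qed.

Lemma wt2_inv_euler : D t = M ^+ 3 - t ^+ 3.
Proof.
rewrite /wt2_inv eulerD eulerN euler_natM eis4_euler // eis4_q2_euler // -/wt2_inv.
rewrite eis4_t eis4_q2_t; ring7_with char7 mulMt.
Qed.

Lemma wt2_euler : D M = t - M ^+ 5.
Proof.
have := congr1 D mulMt; rewrite euler0M euler1 wt2_inv_euler => H.
apply: (eq_of_lincomb (c := M) H).
have -> : D M - (t - M ^+ 5) = M * t * D M - (t - M ^+ 5) by rewrite mulMt mul1r.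
ring7_with char7 mulMt.
Qed.

Definition eta_quot : {fps F} := 4%:R * (M ^+ 2 - t).

(** The cofactor f^2 + f g + g^2 of f - g has coefficient 3 at q^2, which is nonzero. *)
Lemma fps_cube_inj f g : f 0%N = 0 -> f 1%N = 1 -> g 0%N = 0 -> g 1%N = 1 ->
  f ^+ 3 = g ^+ 3 -> f = g.
Proof.
move=> f0 f1 g0 g1 fg3.
have : (f * f + f * g + g * g) * (f - g) = 0.
  by rewrite -[RHS](subrr (g ^+ 3)) -{1}fg3; ring.
move/fps_mulf_eq0 => /(_ 2%N) H; apply/eqP; rewrite -subr_eq0; apply/eqP/H.
rewrite !fpsDE (fps_coef2M f f) (fps_coef2M f g) (fps_coef2M g g) f0 f1 g0 g1.
rewrite !(mul0r, mulr0, add0r, addr0, mulr1) -[1 + 1]/(2%:R) natr1.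
by rewrite F7_natr_eq0.
Qed.

Lemma qB16 : q * B ^+ 16 = eta_quot * A ^+ 8.
Proof.
have [T0 T1 _] := eis4_q2_coef pcharF frobF.
have Q0 := eis4_coef0 pcharF frobF; have Q1 := eis4_coef1 pcharF frobF.
have t0 : t 0%N = 1.
  by rewrite /wt2_inv fpsDE fpsNE fps_natME Q0 T0; ring.
have t1 : t 1%N = 4%:R.
  by rewrite /wt2_inv fpsDE fpsNE fps_natME Q1 T1; ring.
have M2_0 : (M ^+ 2) 0%N = 1.
  by rewrite wt2_sqr fpsDE fpsNE !fps_natME Q0 T0; ring.
have M2_1 : (M ^+ 2) 1%N = 6%:R.
  by rewrite wt2_sqr fpsDE fpsNE !fps_natME Q1 T1; ring.
have N0 : eta_quot 0%N = 0 by rewrite /eta_quot fps_natME fpsDE fpsNE M2_0 t0; ring.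
have N1 : eta_quot 1%N = 1.
  rewrite /eta_quot fps_natME fpsDE fpsNE M2_1 t1; ring7F.
apply: fps_cube_inj.
- by rewrite fps_coef0M mul0r.
- by rewrite -[q]expr1 fpsXnME subnn fps_coef0X euler_prod0 expr1n.
- by rewrite fps_coef0M N0 mul0r.
- by rewrite fps_coef1M N0 N1 fps_coef0X euler_prod0 expr1n; ring.
(* After cubing, a further factor q turns the claim into (1 - T^3)^2 = N^3 (1 - Q^3), with N =
   [eta_quot]: an identity on the rational curve. *)
apply: (@fpsXnM_inj _ 1); rewrite expr1.
transitivity ((q ^+ 2 * B ^+ 24) ^+ 2); first by move: A B q => x y z; ring.
transitivity (eta_quot ^+ 3 * (q * A ^+ 24)); last by move: eta_quot A q => x y z; ring.
rewrite (q2B24 pcharF frobF) (qA24 pcharF frobF) /eta_quot eis4_t eis4_q2_t.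
ring7_with char7 mulMt.
Qed.

Lemma coef_iter6_euler c f g :
  iter 6 (euler c) f = g -> forall n, n%:R + c = 0 -> f n = (f - g) n.
Proof.
by move=> <- n nc0; rewrite fpsDE fpsNE iter_eulerE nc0 expr0n mul0r subr0.
Qed.

Local Notation G := (A ^+ 4 * B ^+ 6).

(** Since (D + 2)^6 f has no terms in this class, only f - (D + 2)^6 f = 6 q^5 G^7 contributes, and
    G^7 = G(q^7). *)
Lemma diamond_dissection n : (A ^+ 4 / B ^+ 6) (7 * n + 5)%N = 6%:R * G n.
Proof.
set f := A ^+ 4 / B ^+ 6.
have L : logder 2%:R f (4%:R * (5%:R * (2%:R * t - M ^+ 2) ^+ 2)
    - 6%:R * (3%:R * (3%:R * t - 2%:R * M ^+ 2) ^+ 2)).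
  have := logderM (logderX 4 (logder_AQ pcharF frobF))
    (logderV (unitrX 6 BU) (logderX 6 (logder_BT pcharF frobF))).
  have -> : 4%:R * 5%:R - 6%:R * 3%:R = 2%:R :> F by ring7F.
  by rewrite -eis4_t -eis4_q2_t.
have f6 := iter6_euler_diamond mulMt wt2_inv_euler wt2_euler L.
rewrite -eis4_t -eis4_q2_t in f6.
rewrite (coef_iter6_euler f6); last first.
  rewrite natrD natrM; ring7F.
have -> : f - (1 - 6%:R * (1 - Q ^+ 3) * (1 - T ^+ 3) ^+ 2) * f =
    6%:R * (q ^+ 5 * G ^+ 7).
  have fB : f * B ^+ 6 = A ^+ 4 by rewrite mulrVK // unitrX.
  rewrite -(qA24 pcharF frobF) -(q2B24 pcharF frobF); move: fB.
  move: f A B q {L f6} => f x y z H.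
  transitivity (6%:R * (z ^+ 5 * (x ^+ 24 * y ^+ 42 * (f * y ^+ 6)))); first by ring.
  by rewrite H; ring.
have n5 : (7 * n + 5 < 5)%N = false by lia.
rewrite fps_natME fpsXnME n5 addnK (fps_frobenius pcharF frobF) subst_qXE.
by rewrite dvdn_mulr // mulKn.
Qed.

Definition gf49 : {fps F} := 6%:R * M * (A ^+ 4)^-1 * B ^+ 10.

Lemma G_dissection m : G (7 * m + 4)%N = gf49 m.
Proof.
have L : logder 3%:R G (4%:R * (5%:R * (2%:R * t - M ^+ 2) ^+ 2)
    + 6%:R * (3%:R * (3%:R * t - 2%:R * M ^+ 2) ^+ 2)).
  have := logderM (logderX 4 (logder_AQ pcharF frobF))
    (logderX 6 (logder_BT pcharF frobF)).
  have -> : 4%:R * 5%:R + 6%:R * 3%:R = 3%:R :> F by ring7F.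
  by rewrite -eis4_t -eis4_q2_t.
have g6 := iter6_euler_G mulMt wt2_inv_euler wt2_euler L; rewrite -/eta_quot in g6.
rewrite (coef_iter6_euler g6); last first.
  rewrite natrD natrM; ring7F.
have -> : G - (1 - 6%:R * eta_quot ^+ 4 * M ^+ 7) * G = q ^+ 4 * gf49 ^+ 7.
  have A4U : A ^+ 4 \is a GRing.unit by rewrite unitrX.
  have HA : gf49 * A ^+ 4 = 6%:R * M * B ^+ 10.
    by rewrite /gf49 mulrAC mulrVK.
  (* The factor A^32 clears the denominator A^28 of [gf49 ^+ 7] and turns [eta_quot ^+ 4] into q^4
     B^64. *)
  have NA := qB16; apply: (mulIr (unitrX 8 A4U)).
  move: HA NA {g6 L A4U}; move: gf49 eta_quot M A B q => h nn mm x y z HA NA.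
  transitivity (6%:R * mm ^+ 7 * x ^+ 4 * y ^+ 6 * (nn * x ^+ 8) ^+ 4).
    by ring.
  transitivity (z ^+ 4 * (h * x ^+ 4) ^+ 7 * x ^+ 4); last by ring.
  rewrite HA -NA; ring7.
have m4 : (7 * m + 4 < 4)%N = false by lia.
rewrite fpsXnME m4 addnK (fps_frobenius pcharF frobF) subst_qXE.
by rewrite dvdn_mulr // mulKn.
Qed.

Lemma gf49_euler : iter 3 (euler 3%:R) gf49 = - gf49.
Proof.
rewrite /gf49 -mulrA; apply: (iter3_euler_gf49 mulMt wt2_inv_euler wt2_euler).
rewrite -eis4_t -eis4_q2_t.
have := logderM (logderV (unitrX 4 AU) (logderX 4 (logder_AQ pcharF frobF)))
  (logderX 10 (logder_BT pcharF frobF)).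
by have -> : - (4%:R * 5%:R) + 10%:R * 3%:R = 3%:R :> F by ring7F.
Qed.

End Uniformizer.

(** * The diamond generating function modulo 7 and the congruences *)

Lemma eq_fps_prod (R : comNzRingType) (F G : nat -> {fps R}) :
  (forall m, (0 < m)%N -> F m = G m) -> fps_prod F = fps_prod G.
Proof.
move=> FG; apply: fpsP => n /=; congr (fps_coef _ n).
by apply: eq_big_nat => m /andP[m0 _]; apply: FG.
Qed.

(** Denominators are cleared over the integers, so that the infinite products combine factor by
    factor. *)
Lemma diamond_GF_euler_prod :
  brokenDiamondGF 3 * (euler_prod int 1 ^+ 3 * euler_prod int 14) =
  euler_prod int 2 * euler_prod int 7.
Proof.
pose good (f : nat -> {fps int}) := forall m, (0 < m)%N -> fps_eqmod m (f m) 1.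
pose e d m : {fps int} := 1 - 'q ^+ (d * m).
have gE d : (0 < d)%N -> good (e d) by move=> d0 m _; apply: euler_factor_eqmod.
have gM f g : good f -> good g -> good (fun m => f m * g m).
  move=> f1 g1 m m0 i ltim.
  by rewrite (fps_eqmodM (f1 m m0) (g1 m m0) ltim) mulr1.
have g1 := gE 1 isT; have g14 := gE 14 isT.
have g2 := gM _ _ g1 g14; have g3 := gM _ _ g1 g2; have g4 := gM _ _ g1 g3.
have gB : good (brokenDiamondFactor 3) := @brokenDiamondFactor_eqmod 3.
have -> : euler_prod int 1 ^+ 3 * euler_prod int 14 = euler_prod int 1 *
  (euler_prod int 1 * (euler_prod int 1 * euler_prod int 14)) by ring.
rewrite /brokenDiamondGF !euler_prodE.
rewrite -(fps_prodM g1 g14) -(fps_prodM g1 g2) -(fps_prodM g1 g3) -(fps_prodM gB g4).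
rewrite -(fps_prodM (gE 2 isT) (gE 7 isT)).
apply: eq_fps_prod => m m0; rewrite /brokenDiamondFactor /e mul1n.
have -> : (1 - 'q ^+ m) * ((1 - 'q ^+ m) * ((1 - 'q ^+ m) * (1 - 'q ^+ (14 * m))))
  = (1 - 'q ^+ m) ^+ 3 * (1 - 'q ^+ (14 * m)) by ring.
by rewrite mulrVK // (brokenDiamond_den_unit 3 m0).
Qed.

Section DiamondModulo7.
Variable F : fieldType.
Hypothesis pcharF : 7 \in [pchar F].
Hypothesis frobF : forall x : F, x ^+ 7 = x.

(** Frobenius replaces the products in q^7 and q^14 by A^7 and B^7. *)
Lemma diamond_GF_mod7 :
  fps_map (intr : {rmorphism int -> F}) (brokenDiamondGF 3) =
  euler_prod F 1 ^+ 4 / euler_prod F 2 ^+ 6.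
Proof.
set GF := fps_map _ _.
have E d : (0 < d)%N -> euler_prod F (7 * d) = euler_prod F d ^+ 7.
  by move=> d0; rewrite (fps_frobenius pcharF frobF) subst_euler_prod.
have E7 : euler_prod F 7 = euler_prod F 1 ^+ 7 := E 1%N isT.
have E14 : euler_prod F 14 = euler_prod F 2 ^+ 7 := E 2%N isT.
have := congr1 (fps_map (intr : {rmorphism int -> F})) diamond_GF_euler_prod.
rewrite !fps_mapM -/GF !fps_map_euler_prod E7 E14 => H.
have U1 := euler_prod_unit F 1; have U2 := euler_prod_unit F 2.
apply: (mulIr (unitrX 6 U2)); rewrite mulrVK ?unitrX //.
apply: (mulIr (unitrX 3 U1)); apply: (mulIr U2).
move: H {E E7 E14 U1 U2}; move: GF (euler_prod F 1) (euler_prod F 2) => g x y H.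
by apply: (eq_of_lincomb (c := 1) H); ring.
Qed.

(** Two dissections lead to coefficient 7 n + r of [gf49], which [gf49_euler] multiplies by (r +
    3)^3 + 1 to get 0. *)
Lemma Delta_mod7_eq0 n r : (r%:R + 3%:R : F) ^+ 3 != -1 ->
  (Delta 3 (7 * (7 * (7 * n + r) + 4) + 5)%N)%:~R = 0 :> F.
Proof.
move=> r3; rewrite /Delta -[LHS]/(fps_map (intr : {rmorphism int -> F}) _ _).
rewrite diamond_GF_mod7 (diamond_dissection pcharF frobF) (G_dissection pcharF frobF).
suff -> : gf49 F (7 * n + r)%N = 0 by rewrite mulr0.
have := congr1 (fun f : {fps F} => f (7 * n + r)%N) (gf49_euler pcharF frobF).
rewrite iter_eulerE natrD natrM (pcharf0 pcharF) mul0r add0r fpsNE => H.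
apply/eqP; have : ((r%:R + 3%:R) ^+ 3 + 1) * gf49 F (7 * n + r)%N == 0.
  by rewrite mulrDl H mul1r addNr.
by rewrite mulf_eq0 addr_eq0 (negPf r3).
Qed.
End DiamondModulo7.

Theorem theorem1p1 (n : nat) :
  [/\ (Delta 3 (7 ^ 3 * n + 82)%N = 0 %[mod 7])%Z,
      (Delta 3 (7 ^ 3 * n + 229)%N = 0 %[mod 7])%Z,
      (Delta 3 (7 ^ 3 * n + 278)%N = 0 %[mod 7])%Z
    & (Delta 3 (7 ^ 3 * n + 327)%N = 0 %[mod 7])%Z].
Proof.
have F7p : 7 \in [pchar 'F_7] by apply: pchar_Fp.
have F7_frob (x : 'F_7) : x ^+ 7 = x.
  by rewrite -[x]natr_Zp -[LHS](pFrobenius_autE F7p) pFrobenius_aut_nat.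
have key r : ((r%:R + 3%:R : 'F_7) ^+ 3 != -1) ->
    (Delta 3 (7 ^ 3 * n + (49 * r + 33))%N = 0 %[mod 7])%Z.
  move/(Delta_mod7_eq0 F7p F7_frob n).
  have -> : (7 * (7 * (7 * n + r) + 4) + 5 = 7 ^ 3 * n + (49 * r + 33))%N by lia.
  move: (Delta _ _) => x /eqP; rewrite -(dvdz_pcharf F7p) => /dvdz_mod0P ->.
  by rewrite mod0z.
(* For r = 1, 4, 5, 6 the number 49 r + 33 is 82, 229, 278, 327, and (r + 3)^3 is 1, 0, 1, 1 modulo
   7. *)
by split; [apply: (key 1%N) | apply: (key 4) | apply: (key 5) | apply: (key 6)].
Qed.
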